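(* Let $M[*]$ be a compact (connected) generalized product and let $k\ge 2$. The diagonals $D_{\mathfrak P}\subset M[k]$, where $\mathfrak P$ runs over the partitions of $J(k)$ having at least one part with two or more elements, form a p-clean collection of submanifolds of $M[k]$ which is closed under intersection. The `true diagonals' $D_P\subset M[k]$, for single subsets $P\subset J(k)$ with at least two elements, form a p-clean collection which is closed under non-transversal intersection.
   Context: Manifolds with corners have embedded boundary hypersurfaces, each boundary hypersurface having a boundary defining function. Adapted coordinates near a point consist of the $x_1,\dots,x_r\ge 0$ defining the boundary hypersurfaces through the point and further functions $y_l$, giving a diffeomorphism of a neighbourhood onto $[0,\epsilon)^r\times(-\epsilon,\epsilon)^{n-r}$. A b-map $F:M_1\to M_2$ is a smooth map such that for each boundary defining function $x'_j$ of $M_2$ either $F^*x'_j\equiv 0$ or $F^*x'_j=\alpha_j\prod_k x_k^{a(j,k)}$ with $\alpha_j>0$ smooth and $a(j,k)$ non-negative integers, where the $x_k$ are boundary defining functions of $M_1$; it is an interior b-map if the first case does not occur. A p-submanifold is a closed subset which near each of its points is given, in some adapted coordinates, by the vanishing of some of the $x_i$ and some of the $y_l$. A p-embedding is a diffeomorphism onto a p-submanifold. A b-fibration is a surjective b-map $F:M_1\to M_2$ such that near each $m\in M_1$ there are adapted coordinates $x,y$, and adapted coordinates $x',y'$ near $F(m)$, such that the $F^*y'_{l'}$ are amongst the $y_l$ and $F^*x'_{j'}=\prod_{j\in J(j')}x_j$ where the index sets $J(j')$ are disjoint for different $j'$. Let $J(k)=\{1,\dots,k\}$. A generalized product is a contravariant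 functor from the category with objects the $J(k)$, $k=1,2,\dots$, and morphisms all maps $J(n)\to J(m)$, to manifolds with corners and interior b-maps, $J(k)\mapsto M[k]$, $(I:J(n)\to J(m))\mapsto (S_I:M[m]\to M[n])$, such that $\dim M[k]=\mu+(k-1)\kappa$ for fixed integers $\mu,\kappa$, injective maps $I$ are taken to b-fibrations and surjective maps $I$ are taken to p-embeddings; all manifolds, including the fibres of the b-fibrations, are connected. It is compact if all the $M[k]$ are compact (and connected) and the structural b-fibrations have connected fibres. For a partition $\mathfrak P$ of $J(k)$ with at least one part having two or more elements, $D_{\mathfrak P}\subset M[k]$ is the image of $S_I$ for any surjection $I:J(k)\to J(n)$ whose fibres are precisely the parts of $\mathfrak P$. For $P\subset J(k)$ with at least two elements $D_P$ denotes $D_{\mathfrak P}$ where $\mathfrak P$ has $P$ as its only non-singleton part. A finite collection of p-submanifolds is p-clean if near each point of the union there are adapted coordinates $x_j,y_l$ in which each submanifold of the collection containing that point is defined by the vanishing of a subset of the $x_j$ and some linear functions of the $y_l$. A collection is closed under (non-transversal) intersection if whenever two elements have non-empty (and non-transversal) intersection, the intersection is in the collection. *)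

(* Defs.v *)
From HB Require Import structures.
From mathcomp Require Import all_boot all_order all_algebra.
From mathcomp Require Import all_classical all_reals all_analysis.

Set Implicit Arguments.
Unset Strict Implicit.
Unset Printing Implicit Defensive.

Import Order.TTheory GRing.Theory Num.Theory.
Import numFieldNormedType.Exports.

Local Open Scope classical_set_scope.
Local Open Scope ring_scope.

Section SmoothFunctions.
Variables (R : realType) (n : nat).

Definition iter_partial (s : seq 'I_n) (g : 'rV[R]_n -> R) : 'rV[R]_n -> R :=
  foldr (fun i h x => 'D_(delta_mx 0 i) h x) g s.

(* Meaningful for W open: all iterated partial derivatives of g exist and are
   continuous on W. *)
Definition smooth_on (W : set 'rV[R]_n) (g : 'rV[R]_n -> R) : Prop :=
  forall (s : seq 'I_n) x, W x ->
    {for x, continuous (iter_partial s g)} /\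
    forall i, derivable (iter_partial s g) x (delta_mx 0 i).

End SmoothFunctions.

(* A chart of dimension n: the coordinates c_i with i in [cbd c] are the
   boundary coordinates "x" (required to be >= 0), those with i outside [cbd c]
   are the remaining coordinates "y".  Using a set of indices instead of
   {0, .., r-1} only amounts to not reordering the coordinates.
   [cmap c] is irrelevant outside [cdom c]. *)
Record chart (R : realType) (X : topologicalType) (n : nat) := Chart {
  cdom : set X;
  cbd : {set 'I_n};
  cmap :> X -> 'rV[R]_n }.

Section Charts.
Variables (R : realType) (X : topologicalType) (n : nat).
Implicit Types (c : chart R X n) (p : X).

Definition sector (B : {set 'I_n}) : set 'rV[R]_n :=
  [set v | forall i, i \in B -> 0 <= v 0 i].

(* [0, e[ in the directions of B, ]-e, e[ in the others *)
Definition corner_box (B : {set 'I_n}) (e : R) : set 'rV[R]_n :=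
  [set v | sector B v /\ forall i, `|v 0 i| < e].

(* cmap c is a homeomorphism of the open set cdom c onto a relatively open
   subset of sector (cbd c) *)
Definition chart_ok c : Prop :=
  [/\ open (cdom c),
      forall p q, cdom c p -> cdom c q -> c p = c q -> p = q,
      forall p, cdom c p -> {for p, continuous c} &
      forall V : set X, open V -> V `<=` cdom c ->
        exists2 W : set 'rV[R]_n, open W & c @` V = W `&` sector (cbd c)].

(* g is a smooth extension, to an open neighbourhood W of F p's coordinates in
   the whole of R^n, of the function f expressed in the chart c through F *)
Definition local_rep (Y : topologicalType) c (F : Y -> X) (f : Y -> R) (p : Y)
    (W : set 'rV[R]_n) (g : 'rV[R]_n -> R) : Prop :=
  [/\ open W, W (c (F p)), smooth_on W g & \forall q \near p, f q = g (c (F q))].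

Definition smooth_in c (f : X -> R) p : Prop :=
  exists W g, local_rep c id f p W g.

Definition compatible c c' : Prop :=
  forall p, cdom c p -> cdom c' p ->
    (forall i, smooth_in c (fun q => c' q 0 i) p) /\
    (forall i, smooth_in c' (fun q => c q 0 i) p).

End Charts.

Record atlased (R : realType) := Atlased {
  carrier :> topologicalType;
  mdim : nat;
  atlas : set (chart R carrier mdim) }.

Section Corners.
Variable R : realType.
Implicit Type M : atlased R.

Definition coords M (c : chart R M (mdim M)) : Prop :=
  chart_ok c /\ forall c', atlas c' -> compatible c c'.

(* Adapted coordinates near p. *)
Definition adapted M (p : M) (c : chart R M (mdim M)) : Prop :=
  [/\ coords c, cdom c p, c p = 0 &
      exists2 e : R, 0 < e & c @` cdom c = corner_box (cbd c) e].

Definition smooth_fun M (f : M -> R) : Prop :=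
  forall p c, coords c -> cdom c p -> smooth_in c f p.

Definition codim1_points M : set M :=
  [set p | exists2 c, adapted p c & #|cbd c| = 1%N].

Arguments codim1_points M : clear implicits.

(* Boundary hypersurfaces: closures of the connected components of the set of
   boundary points of codimension one. *)
Definition bhypersurface M (H : set M) : Prop :=
  exists2 p, codim1_points M p &
    H = closure (connected_component (codim1_points M) p).

(* x >= 0 is smooth, H = {x = 0}, and dx <> 0 at every point of H. *)
Definition bdf M (H : set M) (x : M -> R) : Prop :=
  [/\ bhypersurface H, smooth_fun x, forall p, 0 <= x p,
      H = [set p | x p = 0] &
      forall p, H p -> exists c W g,
        [/\ coords c, cdom c p, local_rep c id x p W g &
            exists i, 'D_(delta_mx 0 i) g (c p) != 0]].

(* The last condition forces the boundary hypersurfaces to be embedded: if H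
   met a corner along two coordinate faces {x_1 = 0} and {x_2 = 0}, the
   differential of a function vanishing on H would vanish there. *)
Definition corners_axiom M : Prop :=
  [/\ hausdorff_space M /\ @second_countable M,
      forall c, atlas (a := M) c -> chart_ok c,
      forall c c', atlas (a := M) c -> atlas c' -> compatible c c',
      forall p : M, exists2 c, atlas c & cdom c p &
      forall H : set M, bhypersurface H -> exists x, bdf H x].

End Corners.

Record mfd (R : realType) := Mfd {
  mfd_base :> atlased R;
  mfdP : corners_axiom mfd_base }.

Section Maps.
Variable R : realType.
Implicit Types M : mfd R.

Definition smooth_map M1 M2 (F : M1 -> M2) : Prop :=
  continuous F /\
  forall p c1 c2, coords c1 -> cdom c1 p -> coords c2 -> cdom c2 (F p) ->
    forall i, smooth_in c1 (fun q => c2 (F q) 0 i) p.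

(* f = alpha * \prod_k x_k ^ a_k with alpha > 0 smooth and the x_k boundary
   defining functions; several x_k may define the same hypersurface, which just
   adds up their exponents. *)
Definition bdf_monomial M (f : M -> R) : Prop :=
  exists (alpha : M -> R) (N : nat) (x : 'I_N -> M -> R) (a : 'I_N -> nat),
    [/\ smooth_fun alpha, forall p, 0 < alpha p,
        forall k, exists H, bdf H (x k) &
        forall p, f p = alpha p * \prod_k x k p ^+ a k].

Definition bmap M1 M2 (F : M1 -> M2) : Prop :=
  smooth_map F /\
  forall H x', bdf (M := M2) H x' ->
    (forall p, x' (F p) = 0) \/ bdf_monomial (x' \o F).

Definition interior_bmap M1 M2 (F : M1 -> M2) : Prop :=
  bmap F /\ forall H x', bdf (M := M2) H x' -> ~ (forall p, x' (F p) = 0).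

Definition p_submanifold M (S : set M) : Prop :=
  closed S /\
  forall p, S p -> exists c (A : {set 'I_(mdim M)}), adapted p c /\
    forall q, cdom c q -> (S q <-> forall i, i \in A -> c q 0 i = 0).

(* A function on a p-submanifold is smooth when it is locally the restriction
   of a smooth function; the last condition says that the inverse of F, defined
   on range F, is smooth in this sense. *)
Definition p_embedding M1 M2 (F : M1 -> M2) : Prop :=
  [/\ smooth_map F /\ p_submanifold (range F),
      injective F,
      forall V : set M1, open V ->
        exists2 W : set M2, open W & F @` V = W `&` range F &
      forall p c1 c2, coords c1 -> cdom c1 p -> coords c2 -> cdom c2 (F p) ->
        forall i, exists W g, local_rep c2 F (fun q => c1 q 0 i) p W g].

(* Near m: F^* y'_l = y_(sigma l) with sigma injective, and
   F^* x'_j = \prod_(i in J j) x_i with the J j pairwise disjoint. *)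
Definition bfibration M1 M2 (F : M1 -> M2) : Prop :=
  [/\ bmap F, forall q, exists p, F p = q &
      forall m, exists c1 c2,
        [/\ adapted m c1, adapted (F m) c2,
            forall p, cdom c1 p -> cdom c2 (F p) &
        exists (sigma : 'I_(mdim M2) -> 'I_(mdim M1))
               (J : 'I_(mdim M2) -> {set 'I_(mdim M1)}),
        [/\ forall l l', l \notin cbd c2 -> l' \notin cbd c2 ->
              sigma l = sigma l' -> l = l',
            forall l, l \notin cbd c2 -> sigma l \notin cbd c1 /\
              forall p, cdom c1 p -> c2 (F p) 0 l = c1 p 0 (sigma l),
            forall j j', j \in cbd c2 -> j' \in cbd c2 ->
              forall i, i \in J j -> i \in J j' -> j = j' &
            forall j, j \in cbd c2 -> J j \subset cbd c1 /\
              forall p, cdom c1 p -> c2 (F p) 0 j = \prod_(i in J j) c1 p 0 i]]].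

(* In each adapted chart the members through p are cut out by x_i = 0, i in A,
   and by the vanishing of the linear functions \sum_i (L i j) y_i of the y's. *)
Definition p_clean M (C : set (set M)) : Prop :=
  [/\ finite_set C, forall S, C S -> p_submanifold S &
      forall p, (exists2 S, C S & S p) -> exists2 c, adapted p c &
        forall S, C S -> S p ->
        exists (A : {set 'I_(mdim M)}) (m : nat) (L : 'M[R]_(mdim M, m)),
          A \subset cbd c /\
          forall q, cdom c q ->
            (S q <-> (forall i, i \in A -> c q 0 i = 0) /\
               forall j, \sum_(i | i \notin cbd c) L i j * c q 0 i = 0)].

(* The tangent space T_p S read in the coordinates c: the vectors killed by the
   differentials at p of all smooth functions vanishing on S near p. *)
Definition tangent M (c : chart R M (mdim M)) (S : set M) (p : M)
    : set 'rV[R]_(mdim M) :=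
  [set v | forall W g, open W -> W (c p) -> smooth_on W g ->
     (forall q, cdom c q -> S q -> W (c q) -> g (c q) = 0) ->
     'D_v g (c p) = 0].

Definition transversal M (S T : set M) : Prop :=
  forall p c, S p -> T p -> coords c -> cdom c p ->
    forall v, exists u w, [/\ tangent c S p u, tangent c T p w & v = u + w].

Definition closed_under_intersection M (C : set (set M)) : Prop :=
  forall S T, C S -> C T -> S `&` T !=set0 -> C (S `&` T).

Definition closed_under_nontransversal_intersection M (C : set (set M)) : Prop :=
  forall S T, C S -> C T -> S `&` T !=set0 -> ~ transversal S T -> C (S `&` T).

End Maps.

(* J(k) with k >= 1 is 'I_k for k of the form _.+1, and gspace k is M[k];
   gspace 0 is not constrained and plays no role. *)
Record gproduct (R : realType) := GProduct {
  gspace :> nat -> mfd R;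
  gmap : forall n m, ('I_n.+1 -> 'I_m.+1) -> gspace m.+1 -> gspace n.+1;
  gmu : int;
  gkappa : int;
  gmap_id : forall n (q : gspace n.+1), gmap id q = q;
  gmap_comp : forall l n m (I : 'I_n.+1 -> 'I_m.+1) (I' : 'I_l.+1 -> 'I_n.+1)
    (q : gspace m.+1), gmap (I \o I') q = gmap I' (gmap I q);
  gmap_interior : forall n m (I : 'I_n.+1 -> 'I_m.+1), interior_bmap (gmap I);
  gdim : forall k, (mdim (gspace k.+1))%:Z = gmu + k%:Z * gkappa;
  gmap_inj : forall n m (I : 'I_n.+1 -> 'I_m.+1),
    injective I -> bfibration (gmap I);
  gmap_surj : forall n m (I : 'I_n.+1 -> 'I_m.+1),
    (forall j, exists i, I i = j) -> p_embedding (gmap I);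
  gspace_connected : forall k, connected [set: gspace k.+1];
  gfibre_connected : forall n m (I : 'I_n.+1 -> 'I_m.+1) (q : gspace n.+1),
    injective I -> connected (gmap I @^-1` [set q]) }.

Definition gproduct_compact (R : realType) (M : gproduct R) : Prop :=
  forall k, compact [set: M k.+1].

Section Diagonals.
Variables (R : realType) (M : gproduct R) (k : nat).
Implicit Types (P : {set {set 'I_k.+1}}) (B : {set 'I_k.+1}).

(* The image of gmap I depends only on the fibres of the surjection I, since
   two surjections with the same fibres differ by a bijection of the target;
   the union over all such I is thus the image of any one of them. *)
Definition diag P : set (M k.+1) :=
  [set q | exists n (I : 'I_k.+1 -> 'I_n.+1),
     [/\ forall j, exists i, I i = j,
         finset.preim_partition I [set: 'I_k.+1]%SET = P & range (gmap (g := M) I) q]].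

Definition single_partition B : {set {set 'I_k.+1}} :=
  (B |: [set [set i] | i in ~: B])%SET.

Definition diagonals : set (set (M k.+1)) :=
  [set D | exists P : {set {set 'I_k.+1}},
     [/\ finset.partition P [set: 'I_k.+1]%SET,
         exists2 B, B \in P & (1 < #|B|)%N & D = diag P]].

Definition true_diagonals : set (set (M k.+1)) :=
  [set D | exists2 B : {set 'I_k.+1}, (1 < #|B|)%N &
     D = diag (single_partition B)].

End Diagonals.

Arguments diagonals {R} M k.
Arguments true_diagonals {R} M k.

(* Main.v *)
Require Import Defs.
From HB Require Import structures.
From mathcomp Require Import all_boot all_order all_algebra.
From mathcomp Require Import all_classical all_reals all_analysis.
From mathcomp Require Import ring lra zify.

(* Write S_a for the structural map of a : J(k) -> J(k). If a map e is idempotent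
   with kernel partition P, then D_P is the fixed point set of S_e; a point q of
   D_P is moreover fixed by S_a for every a preserving the blocks of P. Hence
   the intersections of diagonals are governed by the monoid of all a with
   S_a q = q, and D_P meets D_Q exactly in D_J, J the join of P and Q.

   The dimension formula enters through traces: at a fixed point the
   differential of S_e, e idempotent of rank m, is idempotent of trace
   dim M[m] = mu + (m-1) kappa. For disjoint B and B' the differentials E and F
   of the two collapsing maps commute, and E + F - EF is an idempotent of trace
   dim M[k], hence the identity: D_B and D_B' are transversal.

   For p-cleanness at p, let r be an idempotent whose kernel is the largest
   partition with p on its diagonal. Collapsing everything by r, except that a
   single point i is kept, gives idempotents E_i, and E_r + sum_i (E_i - E_r) is
   the identity, again by computing its trace. Therefore the map q |-> c(S_r q),
   together with the differences c(S_h q) - c(S_r q), where h puts the point i in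
   a slot depending only on its block, is a local coordinate system after the
   appropriate linear projections. In these coordinates the diagonals through p
   say that the differences attached to two points of a block are equal, or that
   they vanish. Near the boundary, the b-fibration and p-embedding properties
   show that S_r preserves the boundary coordinates of a suitable chart c, so
   that these can be kept unchanged. *)

Set Implicit Arguments.
Unset Strict Implicit.
Unset Printing Implicit Defensive.

Import Order.TTheory GRing.Theory Num.Theory.
Import numFieldNormedType.Exports.

Local Open Scope classical_set_scope.
Local Open Scope ring_scope.

(** * First-order expansions *)

Section RowNorm.
Variable R : realType.

Lemma rV_norm_le n (v : 'rV[R]_n) e :
  0 <= e -> (forall i, `|v 0 i| <= e) -> `|v| <= e.
Proof.
move=> e0 h; rewrite [leLHS]/Num.norm /= mx_normrE; apply/bigmax_leP; split=> //.
by case=> i j _ /=; rewrite ord1.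
Qed.

Lemma rV_norm_ge n (v : 'rV[R]_n) i : `|v 0 i| <= `|v|.
Proof.
rewrite [leRHS]/Num.norm /= mx_normrE.
exact: (le_bigmax _ (fun ij : 'I_1 * 'I_n => `|v ij.1 ij.2|) (0, i)).
Qed.

Lemma rV_norm_lt n (v : 'rV[R]_n) e :
  0 < e -> (forall i, `|v 0 i| < e) -> `|v| < e.
Proof.
move=> e0 h; rewrite [ltLHS]/Num.norm /= mx_normrE; apply/bigmax_ltP; split=> //.
by case=> i j _ /=; rewrite ord1.
Qed.

Lemma mulmx_bound n m (A : 'M[R]_(n, m)) :
  exists2 C, 0 < C & forall v : 'rV[R]_n, `|v *m A| <= C * `|v|.
Proof.
exists (1 + \sum_i \sum_j `|A i j|).
  by rewrite ltr_pwDl// sumr_ge0// => i _; rewrite sumr_ge0.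
move=> v; apply: rV_norm_le => [|j].
  by rewrite mulr_ge0// addr_ge0// sumr_ge0// => i _; rewrite sumr_ge0.
rewrite mxE; apply: le_trans (ler_norm_sum _ _ _) _.
rewrite mulrDl mul1r; apply: ler_wpDl => //.
rewrite mulr_suml; apply: ler_sum => i _.
rewrite normrM mulrC; apply: ler_pM => //; last exact: rV_norm_ge.
by rewrite (bigD1 j)//= lerDl sumr_ge0.
Qed.

Lemma near_dist (V : normedModType R) (v : V) e :
  0 < e -> \forall w \near v, `|v - w| <= e.
Proof. by move=> e0; have /cvgrPdist_le := @cvg_id _ (nbhs v); apply. Qed.

Lemma rV_continuous (T : topologicalType) n (F : T -> 'rV[R]_n) p :
  (forall i, {for p, continuous (fun q => F q 0 i)}) -> {for p, continuous F}.
Proof.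
move=> h; apply/cvgrPdist_le => e e0.
have : \forall q \near p, forall i, `|F p 0 i - F q 0 i| <= e.
  by apply: filter_forall => i; move/cvgrPdist_le : (h i); apply.
apply: filterS => q hq; apply: rV_norm_le => [|i]; first exact: ltW.
by rewrite !mxE; apply: hq.
Qed.

Lemma coord_near (T : topologicalType) n (F : T -> 'rV[R]_n) p i :
  {for p, continuous F} -> {for p, continuous (fun q => F q 0 i)}.
Proof.
move=> h; exact: (continuous_comp h (@coord_continuous _ _ _ 0 i _)).
Qed.

End RowNorm.

(* Expansion of F with respect to the R^n-valued function u: it makes sense on
   any space, in particular on a manifold with corners with u a chart, where no
   extension across the boundary is needed. *)
Definition fdiff (R : realType) (T : topologicalType) n m
    (u : T -> 'rV[R]_n) (F : T -> 'rV[R]_m) (p : T) (A : 'M[R]_(n, m)) : Prop :=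
  forall e, 0 < e ->
    \forall q \near p, `|F q - F p - (u q - u p) *m A| <= e * `|u q - u p|.

Definition scalar_row (R : realType) (T : Type) (f : T -> R) : T -> 'rV[R]_1 :=
  fun q => const_mx (f q).

Section Fdiff.
Variables (R : realType) (T : topologicalType).

Lemma fdiff_bound n m (u : T -> 'rV[R]_n) (F : T -> 'rV[R]_m) p A :
  fdiff u F p A ->
  exists2 C, 0 < C & \forall q \near p, `|F q - F p| <= C * `|u q - u p|.
Proof.
move=> h; have [C C0 hC] := mulmx_bound A.
exists (1 + C); first by rewrite addr_gt0.
have := h _ ltr01; apply: filterS => q hq.
rewrite -(subrK ((u q - u p) *m A) (F q - F p)).
by apply: le_trans (ler_normD _ _) _; rewrite mulrDl lerD.
Qed.

Lemma fdiff_comp n m l (u : T -> 'rV[R]_n) (F : T -> 'rV[R]_m)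
    (G : T -> 'rV[R]_l) p A B :
  fdiff u F p A -> fdiff F G p B -> fdiff u G p (A *m B).
Proof.
move=> hF hG e e0; have [C C0 hC] := fdiff_bound hF.
have [D D0 hD] := mulmx_bound B.
have eC : 0 < e / 2 / C by rewrite !divr_gt0.
have eD : 0 < e / 2 / D by rewrite !divr_gt0.
near=> q.
have h1 : `|F q - F p - (u q - u p) *m A| <= e / 2 / D * `|u q - u p|.
  by near: q; exact: hF.
have h2 : `|G q - G p - (F q - F p) *m B| <= e / 2 / C * `|F q - F p|.
  by near: q; exact: hG.
have h3 : `|F q - F p| <= C * `|u q - u p| by near: q.
have -> : G q - G p - (u q - u p) *m (A *m B) =
   (G q - G p - (F q - F p) *m B) + (F q - F p - (u q - u p) *m A) *m B.
  by rewrite (mulmxBl (F q - F p)) mulmxA [RHS]addrA subrK.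
apply: le_trans (ler_normD _ _) _.
have -> : e * `|u q - u p| =
    e / 2 / C * (C * `|u q - u p|) + D * (e / 2 / D * `|u q - u p|).
  by field; rewrite !gt_eqF.
apply: lerD; first by apply: le_trans h2 _; rewrite ler_pM2l.
by apply: le_trans (hD _) _; rewrite ler_pM2l.
Unshelve. all: by end_near. Qed.

Lemma fdiff_eq n m (u : T -> 'rV[R]_n) (F F' : T -> 'rV[R]_m) p A :
  (\forall q \near p, F q = F' q) -> fdiff u F p A -> fdiff u F' p A.
Proof.
move=> h hF e e0; have hp : F p = F' p := nbhs_singleton h.
near=> q; have <- : F q = F' q by near: q.
by rewrite -hp; near: q; exact: hF.
Unshelve. all: by end_near. Qed.

Lemma fdiff_mul n m (u : T -> 'rV[R]_n) (A : 'M[R]_(n, m)) p :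
  fdiff u (fun q => u q *m A) p A.
Proof.
move=> e e0; apply: nearW => q.
by rewrite mulmxBl subrr normr0 mulr_ge0// ltW.
Qed.

Lemma fdiff_id n (u : T -> 'rV[R]_n) p : fdiff u u p 1%:M.
Proof.
by move=> e e0; apply: nearW => q; rewrite mulmx1 subrr normr0 mulr_ge0// ltW.
Qed.

Lemma fdiff_cst n m (u : T -> 'rV[R]_n) (w : 'rV[R]_m) p :
  fdiff u (fun=> w) p 0.
Proof.
move=> e e0; apply: nearW => q.
by rewrite mulmx0 subrr subr0 normr0 mulr_ge0// ltW.
Qed.

Lemma fdiffD n m (u : T -> 'rV[R]_n) (F G : T -> 'rV[R]_m) p A B :
  fdiff u F p A -> fdiff u G p B -> fdiff u (fun q => F q + G q) p (A + B).
Proof.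
move=> hF hG e e0; have e2 : 0 < e / 2 by rewrite divr_gt0.
near=> q.
have -> : F q + G q - (F p + G p) - (u q - u p) *m (A + B) =
   (F q - F p - (u q - u p) *m A) + (G q - G p - (u q - u p) *m B).
  rewrite mulmxDr; move: (_ *m A) (_ *m B) => a b.
  by apply/rowP => i; rewrite !mxE; ring.
apply: le_trans (ler_normD _ _) _; rewrite (splitr e) mulrDl.
by apply: lerD; near: q; [exact: hF|exact: hG].
Unshelve. all: by end_near. Qed.

Lemma fdiffM n m l (u : T -> 'rV[R]_n) (F : T -> 'rV[R]_m) p A (B : 'M[R]_(m, l)) :
  fdiff u F p A -> fdiff u (fun q => F q *m B) p (A *m B).
Proof. by move=> h; apply: fdiff_comp h (fdiff_mul _ _ _). Qed.

Lemma fdiffB n m (u : T -> 'rV[R]_n) (F G : T -> 'rV[R]_m) p A B :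
  fdiff u F p A -> fdiff u G p B -> fdiff u (fun q => F q - G q) p (A - B).
Proof.
move=> hF /(@fdiffM _ _ _ _ _ _ _ (- 1%:M)).
rewrite mulmxN mulmx1 => hG.
rewrite (_ : (fun q => _) = (fun q => F q + G q *m (- 1%:M))); first exact: fdiffD.
by apply/funext => q; rewrite mulmxN mulmx1.
Qed.

Lemma fdiff_sum (I : Type) (s : seq I) (P : pred I) n m (u : T -> 'rV[R]_n)
    (F : I -> T -> 'rV[R]_m) p (A : I -> 'M[R]_(n, m)) :
  (forall i, P i -> fdiff u (F i) p (A i)) ->
  fdiff u (fun q => \sum_(i <- s | P i) F i q) p (\sum_(i <- s | P i) A i).
Proof.
move=> h; elim: s => [|i s IH].
  rewrite big_nil (_ : (fun q => _) = fun=> 0); first exact: fdiff_cst.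
  by apply/funext => q; rewrite big_nil.
rewrite big_cons; case: ifP => Pi.
  rewrite (_ : (fun q => _) = fun q => F i q + \sum_(j <- s | P j) F j q).
    by apply: fdiffD => //; exact: h.
  by apply/funext => q; rewrite big_cons Pi.
by rewrite (_ : (fun q => _) = fun q => \sum_(j <- s | P j) F j q)//;
   apply/funext => q; rewrite big_cons Pi.
Qed.

(** After multiplication by [invmx A] the error is at most half of [|u q - u p|], so it is absorbed
    and leaves [|u q - u p| <= 2 * C * |F q - F p|]. Errors small relative to [u] are then small
    relative to [F]. *)
Lemma fdiff_inv n (u F : T -> 'rV[R]_n) p A :
  A \in unitmx -> fdiff u F p A -> fdiff F u p (invmx A).
Proof.
move=> uA h; have [C C0 hC] := mulmx_bound (invmx A).
have key q : u q - u p - (F q - F p) *m invmx A =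
    - ((F q - F p - (u q - u p) *m A) *m invmx A).
  by rewrite [in RHS]mulmxBl mulmxK// opprB.
have C2 : 0 < (2 * C)^-1 by rewrite invr_gt0 mulr_gt0.
have bd : \forall q \near p, `|u q - u p| <= 2 * C * `|F q - F p|.
  have := h _ C2; apply: filterS => q hq.
  have h1 : `|u q - u p| <= C * `|F q - F p| + 2^-1 * `|u q - u p|.
    rewrite -{1}(subrK ((F q - F p) *m invmx A) (u q - u p)) addrC key.
    apply: le_trans (ler_normB _ _) _; rewrite lerD//.
    apply: le_trans (hC _) _.
    apply: le_trans (_ : C * ((2 * C)^-1 * `|u q - u p|) <= _).
      by rewrite ler_pM2l.
    by rewrite mulrA invfM mulrCA divff ?mulr1// gt_eqF.
  by move: h1; lra.
move=> e e0.
have e1 : 0 < e / (2 * C * C) by rewrite divr_gt0 ?mulr_gt0.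
near=> q; rewrite key normrN; apply: le_trans (hC _) _.
have h1 : `|F q - F p - (u q - u p) *m A| <= e / (2 * C * C) * `|u q - u p|.
  by near: q; exact: h.
have h2 : `|u q - u p| <= 2 * C * `|F q - F p| by near: q.
apply: le_trans (_ : C * (e / (2 * C * C) * (2 * C * `|F q - F p|)) <= _).
  by rewrite ler_pM2l//; apply: le_trans h1 _; rewrite ler_pM2l.
rewrite le_eqVlt; apply/orP; left; apply/eqP; field.
by rewrite gt_eqF.
Unshelve. all: by end_near. Qed.

Lemma fdiff_coords n m (u : T -> 'rV[R]_n) (F : T -> 'rV[R]_m) p A :
  (forall i, fdiff u (scalar_row (fun q => F q 0 i)) p (col i A)) ->
  fdiff u F p A.
Proof.
move=> h e e0.
have : \forall q \near p, forall i,
   `|(F q - F p - (u q - u p) *m A) 0 i| <= e * `|u q - u p|.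
  apply: filter_forall => i; have := h i _ e0; apply: filterS => q.
  apply: le_trans; apply: le_trans (rV_norm_ge _ 0).
  rewrite !mxE le_eqVlt; apply/orP; left; apply/eqP; congr (`|_ - _|).
  by apply: eq_bigr => k _; rewrite !mxE.
apply: filterS => q hq; apply: rV_norm_le => // .
by rewrite mulr_ge0// ltW.
Qed.

Lemma fdiff_coord n m (u : T -> 'rV[R]_n) (F : T -> 'rV[R]_m) p A i :
  fdiff u F p A -> fdiff u (scalar_row (fun q => F q 0 i)) p (col i A).
Proof.
move=> h e e0; have := h _ e0; apply: filterS => q; apply: le_trans.
apply: rV_norm_le => // j; apply: le_trans (rV_norm_ge _ i).
rewrite !mxE le_eqVlt; apply/orP; left; apply/eqP; congr (`|_ - _|).
by apply: eq_bigr => k _; rewrite !mxE.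
Qed.

Lemma fdiff_pull (S : topologicalType) (pi : S -> T) n m (u : T -> 'rV[R]_n)
    (F : T -> 'rV[R]_m) s A :
  {for s, continuous pi} -> fdiff u F (pi s) A ->
  fdiff (u \o pi) (F \o pi) s A.
Proof. by move=> c h e e0; have := c _ (h _ e0). Qed.

(** One-sided reachability: at a boundary point a chart takes the values [u p + t *: v] only for
    directions [v] pointing into the sector and [t >= 0]. Such half-lines are enough to determine a
    differential. *)
Definition reaches n (u : T -> 'rV[R]_n) p (v : 'rV[R]_n) : Prop :=
  forall V, nbhs p V -> exists2 e : R, 0 < e &
    forall t, 0 <= t < e -> exists2 q, V q & u q - u p = t *: v.

Lemma reaches_fdiff n m (u : T -> 'rV[R]_n) (F : T -> 'rV[R]_m) p A v :
  reaches u p v -> fdiff u F p A -> forall V e, nbhs p V -> 0 < e ->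
  exists t q, [/\ 0 < t, V q, u q - u p = t *: v &
    `|t^-1 *: (F q - F p) - v *m A| <= e].
Proof.
move=> r h V e hV e0.
have e1 : 0 < e / (1 + `|v|) by rewrite divr_gt0// ltr_pwDl.
have [d d0 hd] := r _ (filterI hV (h _ e1)).
have [|q [Vq hq] uq] := hd (d / 2); first by apply/andP; split; lra.
have t0 : 0 < d / 2 by rewrite divr_gt0.
exists (d / 2), q; split=> //.
move: hq; rewrite uq => hq.
have -> : (d / 2)^-1 *: (F q - F p) - v *m A =
   (d / 2)^-1 *: (F q - F p - (d / 2 *: v) *m A).
  by rewrite -(scalemxAl (d / 2)) [RHS]scalerBr scalerA mulVf ?scale1r// gt_eqF.
rewrite normrZ normfV (gtr0_norm t0) ler_pdivrMl//.
apply: le_trans hq _; rewrite normrZ (gtr0_norm t0) mulrCA ler_pM2l//.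
rewrite mulrAC ler_pdivrMr ?ltr_pwDl// ler_pM2l//; lra.
Qed.

Lemma fdiff_unique n m (u : T -> 'rV[R]_n) (F : T -> 'rV[R]_m) p A B :
  (forall i, reaches u p (delta_mx 0 i)) ->
  fdiff u F p A -> fdiff u F p B -> A = B.
Proof.
move=> r hA hB; have := fdiffB hA hB.
rewrite (_ : (fun q => _) = fun=> 0); last by apply/funext => q; rewrite subrr.
move=> h0; apply/eqP; rewrite -subr_eq0; apply/eqP/row_matrixP => i.
rewrite row0 rowE; apply/eqP; rewrite -normr_le0; apply/ler_addgt0Pr => e e0; rewrite add0r.
have [t [q [_ _ _]]] := reaches_fdiff (r i) h0 filterT e0.
by rewrite subrr scaler0 sub0r normrN.
Qed.

End Fdiff.

(** * The mean value inequality *)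

Section Calculus.
Variables (R : realType).

Definition grad n (g : 'rV[R]_n -> R) (x : 'rV[R]_n) : 'cV[R]_n :=
  \col_i 'D_(delta_mx 0 i) g x.

Lemma fdiff_derive n (g : 'rV[R]_n -> R) x a v :
  fdiff id (scalar_row g) x a -> is_derive x v g ((v *m a) 0 0).
Proof.
move=> h.
suff cv : (fun k : R => k^-1 *: (g (k *: v + x) - g x)) @ 0^' --> (v *m a) 0 0.
  split; last by apply: cvg_lim cv.
  by apply/cvg_ex; exists ((v *m a) 0 0).
apply/(@cvgrPdist_le _ _ _ (0^')%classic) => e e0.
have e1 : 0 < e / (1 + `|v|) by rewrite divr_gt0// ltr_pwDl.
have cx : (fun k : R => k *: v + x) @ (0 : R) --> x.
  rewrite -[X in _ --> X](add0r x) -(scale0r v).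
  by apply: cvgD; [exact: scalel_continuous|exact: cvg_cst].
have H : \forall k \near (0:R),
   `|g (k *: v + x) - g x - (k *: v *m a) 0 0| <= e / (1 + `|v|) * `|k *: v|.
  have := cx _ (h _ e1); apply: (@filterS _ (nbhs (0:R))) => k /=; rewrite addrK; apply: le_trans.
  by apply: le_trans (rV_norm_ge _ 0); rewrite !mxE.
have {}H : \forall k \near (0:R)^',
   `|g (k *: v + x) - g x - (k *: v *m a) 0 0| <= e / (1 + `|v|) * `|k *: v|.
  exact: (@cvg_within _ (nbhs (0 : R)) _ _ _ H).
near=> k; rewrite distrC; have k0 : k != 0 by near: k; exact: nbhs_dnbhs_neq.
have : `|g (k *: v + x) - g x - (k *: v *m a) 0 0| <= e / (1 + `|v|) * `|k *: v|.
  by near: k.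
rewrite -scalemxAl (_ : (k *: (v *m a)) 0 0 = k *: (v *m a) 0 0); last first.
  by rewrite mxE.
move: ((v *m a) 0 0) => d hk.
rewrite (_ : _ - _ = k^-1 *: (g (k *: v + x) - g x - k *: d)); last first.
  by rewrite [RHS]scalerBr scalerA mulVf// scale1r.
rewrite normrZ normfV ler_pdivrMl ?normr_gt0//; apply: le_trans hk _.
rewrite normrZ mulrCA ler_pM2l ?normr_gt0// mulrAC ler_pdivrMr ?ltr_pwDl//.
by rewrite ler_pM2l//; lra.
Unshelve. all: by end_near. Qed.

Lemma MVT_line n (g : 'rV[R]_n -> R) (u : 'rV[R]_n) i (alpha e a b : R) :
  a <= b ->
  (forall t, t \in `[a, b]%R -> derivable g (u + t *: delta_mx 0 i) (delta_mx 0 i) /\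
     `|'D_(delta_mx 0 i) g (u + t *: delta_mx 0 i) - alpha| <= e) ->
  `|g (u + b *: delta_mx 0 i) - g (u + a *: delta_mx 0 i) - (b - a) * alpha|
    <= e * (b - a).
Proof.
move=> ab H; set d := delta_mx 0 i.
have dv t : t \in `[a, b]%R -> is_derive t (1:R) (fun t => g (u + t *: d)) ('D_d g (u + t *: d)).
  move=> /H [dg _].
  have E : (fun k : R => k^-1 *: (((fun t => g (u + t *: d)) \o shift t) (k *: (1:R)) - g (u + t *: d))) =
     (fun k : R => k^-1 *: ((g \o shift (u + t *: d)) (k *: d) - g (u + t *: d))).
    apply/funext => k /=; congr (_ *: (g _ - _)).
    by rewrite scalerDl [(k *: _)%R]mulr1 addrCA.
  by split; rewrite /derivable /derive E.
pose f t := g (u + t *: d); pose df t := 'D_d g (u + t *: d).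
have hd t : t \in `]a, b[%R -> is_derive t (1:R) f (df t).
  by move=> tab; apply: dv; rewrite in_itv /= !ltW ?(itvP tab).
have hc : {within `[a, b], continuous f}.
  apply: derivable_within_continuous => t tab.
  by have [] := dv t tab.
have [c cab] := MVT_segment ab hd hc; rewrite /f => E.
rewrite E (mulrC (b - a)) -mulrBl normrM (ger0_norm (x := b - a)) ?subr_ge0//.
by rewrite ler_wpM2r ?subr_ge0//; have [_] := H c cab.
Qed.

(** The coordinates are changed one at a time, with a one-variable mean value estimate for each,
    whence the factor [n]. The intermediate points stay in the ball because the norm is the maximum
    of the coordinates. *)
Lemma mean_value_box n (g : 'rV[R]_n -> R) (x0 : 'rV[R]_n) r (alpha : 'cV[R]_n) e :
  0 <= e ->
  (forall y, `|y - x0| < r -> forall i, derivable g y (delta_mx 0 i) /\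
     `|'D_(delta_mx 0 i) g y - alpha i 0| <= e) ->
  forall x y, `|x - x0| < r -> `|y - x0| < r ->
    `|g y - g x - ((y - x) *m alpha) 0 0| <= n%:R * e * `|y - x|.
Proof.
move=> e0 H x y hx hy.
have r0 : 0 < r by apply: le_lt_trans hx.
pose mix j : 'rV[R]_n := \row_l (if (l < j)%N then y 0 l else x 0 l).
have mixx : mix 0 = x by apply/rowP => l; rewrite mxE.
have mixy : mix n = y by apply/rowP => l; rewrite mxE ltn_ord.
have step (i : 'I_n) : `|g (mix i.+1) - g (mix i) - (y 0 i - x 0 i) * alpha i 0|
    <= e * `|y - x|.
  pose u := mix i - x 0 i *: delta_mx 0 i.
  have Ei : mix i = u + x 0 i *: delta_mx 0 i by rewrite subrK.
  have Ei1 : mix i.+1 = u + y 0 i *: delta_mx 0 i.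
    rewrite /u; apply/rowP => l; rewrite !mxE eqxx /= ltnS.
    case: (ltngtP l i) => [li|li|/val_inj ->]; last by rewrite eqxx /=; ring.
      rewrite (_ : (l == i) = false) /=; last by apply/negbTE; rewrite neq_ltn li.
      by rewrite !mulr0 subr0 addr0.
    rewrite (_ : (l == i) = false) /=; last by apply/negbTE; rewrite neq_ltn li orbT.
    by rewrite !mulr0 subr0 addr0.
  have ball t a b : a = x 0 i /\ b = y 0 i \/ a = y 0 i /\ b = x 0 i ->
      t \in `[a, b]%R -> `|u + t *: delta_mx 0 i - x0| < r.
    move=> ab; rewrite in_itv /= => /andP[ta tb]; apply: rV_norm_lt => // l.
    rewrite !mxE eqxx /=; case: (ltngtP l i) => [li|li|/val_inj ->].
    - rewrite (_ : (l == i) = false) /=; last by apply/negbTE; rewrite neq_ltn li.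
      rewrite !mulr0 subr0 addr0.
      by apply: le_lt_trans hy; have := rV_norm_ge (y - x0) l; rewrite !mxE.
    - rewrite (_ : (l == i) = false) /=; last by apply/negbTE; rewrite neq_ltn li orbT.
      rewrite !mulr0 subr0 addr0.
      by apply: le_lt_trans hx; have := rV_norm_ge (x - x0) l; rewrite !mxE.
    - rewrite eqxx !mulr1 subrr add0r.
      have := rV_norm_ge (y - x0) i; have := rV_norm_ge (x - x0) i.
      rewrite !mxE => /le_lt_trans/(_ hx) + /le_lt_trans/(_ hy).
      rewrite !ltr_norml => /andP[? ?] /andP[? ?].
      by move: ab => [[? ?]|[? ?]]; apply/andP; split; lra.
  have hyx : `|y 0 i - x 0 i| <= `|y - x|.
    by have := rV_norm_ge (y - x) i; rewrite !mxE.
  apply: (@le_trans _ _ (e * `|y 0 i - x 0 i|)); last by rewrite ler_wpM2l.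
  rewrite Ei Ei1; case: (leP (x 0 i) (y 0 i)) => xy.
    rewrite (ger0_norm (x := y 0 i - _)) ?subr_ge0//; apply: MVT_line => //.
    by move=> t ht; apply: H; apply: ball ht; left.
  (* [MVT_line] wants an increasing interval, so the endpoints are exchanged and the sign is
     absorbed by the norm. *)
  rewrite (ltr0_norm (x := y 0 i - _)) ?subr_lt0// opprB -normrN.
  set p := g _; set q := g _.
  rewrite (_ : - (p - q - _) = q - p - (x 0 i - y 0 i) * alpha i 0); last by ring.
  apply: MVT_line; first exact: ltW.
  by move=> t ht; apply: H; apply: ball ht; right.
have -> : g y - g x - ((y - x) *m alpha) 0 0 =
    \sum_(i < n) (g (mix i.+1) - g (mix i) - (y 0 i - x 0 i) * alpha i 0).
  rewrite sumrB -(big_mkord xpredT (fun i => g (mix i.+1) - g (mix i))).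
  rewrite telescope_sumr// mixx mixy mxE; congr (_ - _).
  by apply: eq_bigr => i _; rewrite !mxE.
apply: le_trans (ler_norm_sum _ _ _) _.
apply: le_trans (ler_sum _ (fun i _ => step i)) _.
by rewrite sumr_const card_ord -[leLHS]mulr_natl mulrA.
Qed.

Lemma C1_fdiff n (W : set 'rV[R]_n) g x :
  open W -> W x -> (forall y, W y -> forall i, derivable g y (delta_mx 0 i)) ->
  (forall i, {for x, continuous ('D_(delta_mx 0 i) g)}) ->
  fdiff id (scalar_row g) x (grad g x).
Proof.
move=> oW Wx dg cg e e0.
(* The division compensates the factor [n] of [mean_value_box]; adding 1 covers dimension 0. *)
have e1 : 0 < e / (1 + n%:R) by rewrite divr_gt0// ltr_pwDl.
have H1 : \forall y \near x, forall i,
     `|'D_(delta_mx 0 i) g y - grad g x i 0| <= e / (1 + n%:R).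
  apply: (@filter_forall _ _ _ (nbhs x)) => i.
  rewrite mxE; have /(@cvgrPdist_le _ _ _ (nbhs x))/(_ _ e1) := cg i.
  by apply: (@filterS _ (nbhs x)) => y; rewrite distrC.
have /(@filterI _ (nbhs x) _ _ _ H1) : nbhs x W by exact: open_nbhs_nbhs.
rewrite -nbhs_ballE => -[r /= r0 hr].
have hb y : `|y - x| < r -> ball x r y by rewrite -ball_normE /= distrC.
have rx : `|x - x| < r by rewrite subrr normr0.
have := nbhsx_ballx x r r0; apply: (@filterS _ (nbhs x)) => y.
rewrite -ball_normE /= distrC => by'.
apply: rV_norm_le => [|k]; first by rewrite mulr_ge0// ltW.
rewrite !ord1 (_ : (_ - _ : 'rV_1) 0 0 = g y - g x - ((y - x) *m grad g x) 0 0).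
  have H z : `|z - x| < r -> forall i, derivable g z (delta_mx 0 i) /\
     `|'D_(delta_mx 0 i) g z - grad g x i 0| <= e / (1 + n%:R).
    by move=> /hb/hr[hz Wz] i; split; [exact: dg|exact: hz].
  apply: le_trans (mean_value_box (ltW e1) H rx by') _.
  rewrite ler_wpM2r// mulrC mulrAC ler_pdivrMr ?ltr_pwDl// ler_pM2l//; lra.
by rewrite !mxE.
Qed.

End Calculus.

(** * Functions of class C^k *)

Section Smooth.
Variables (R : realType).

(** A recursive form of class C^k, suited to inductions on the order for products, composites and
    inverses; [smooth_on] amounts to [Ck k] for all [k]. *)
Fixpoint Ck k n (W : set 'rV[R]_n) (g : 'rV[R]_n -> R) : Prop :=
  (forall x, W x -> {for x, continuous g}) /\
  if k is k'.+1 then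
    (forall x, W x -> forall i, derivable g x (delta_mx 0 i)) /\
    forall i, Ck k' W ('D_(delta_mx 0 i) g)
  else True.

Lemma Ck_cont k n W (g : 'rV[R]_n -> R) x : Ck k W g -> W x -> {for x, continuous g}.
Proof. by case: k => [|k] [c _]; exact: c. Qed.

Lemma Ck_pred k n W (g : 'rV[R]_n -> R) : Ck k.+1 W g -> Ck k W g.
Proof.
elim: k g => [|k IH] g [c [d h]]; split => //; split => // i.
exact/IH/h.
Qed.

Lemma Ck_sub k n (W W' : set 'rV[R]_n) g : W `<=` W' -> Ck k W' g -> Ck k W g.
Proof.
move=> s; elim: k g => [|k IH] g [c h]; split => //.
- by move=> x /s; exact: c.
- by move=> x /s; exact: c.
- by case: h => d h; split=> [x /s|i]; [exact: d|exact/IH/h].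
Qed.

Lemma open_near (T : topologicalType) (W : set T) x : open W -> W x -> \forall y \near x, W y.
Proof. by move=> oW Wx; exact: open_nbhs_nbhs. Qed.

Lemma Ck_eq k n (W : set 'rV[R]_n) f g : open W ->
  (forall x, W x -> f x = g x) -> Ck k W f -> Ck k W g.
Proof.
move=> oW; have E f' g' x : W x -> (forall x, W x -> f' x = g' x) ->
    \forall y \near x, f' y = g' y :> R.
  move=> Wx h; have := open_near oW Wx.
  by apply: (@filterS _ (nbhs x)) => y; exact: h.
have C f' g' : (forall x, W x -> f' x = g' x) ->
    (forall x, W x -> {for x, continuous f'}) ->
    forall x, W x -> {for x, continuous (g' : _ -> R)}.
  move=> h c x Wx; have := c x Wx; rewrite /prop_for /continuous_at -(h x Wx).
  by move=> cx; apply: cvg_trans cx; exact: (@near_eq_cvg _ _ (nbhs x) _ _ _ (E f' g' x Wx h)).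
elim: k f g => [|k IH] f g fg [c h]; split => //; try exact: C c.
case: h => d h; split=> [x Wx i|i].
  by apply: near_eq_derivable (d x Wx i); exact: (E f g x Wx fg).
apply: IH (h i) => x Wx; apply: near_eq_derive; exact: (E f g x Wx fg).
Qed.

Lemma smooth_Ck n (W : set 'rV[R]_n) g : smooth_on W g -> forall k, Ck k W g.
Proof.
move=> h k; elim: k g h => [|k IH] g h; split => //.
- by move=> x Wx; have [] := h [::] x Wx.
- by move=> x Wx; have [] := h [::] x Wx.
- split=> [x Wx|i]; first by have [] := h [::] x Wx.
  (* The last entry of the list is the innermost derivative of [iter_partial], the one taken
     first. *)
  apply: IH => s x Wx; have := h (rcons s i) x Wx.
  by rewrite /iter_partial foldr_rcons.
Qed.

Lemma Ck_smooth n (W : set 'rV[R]_n) g : (forall k, Ck k W g) -> smooth_on W g.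
Proof.
move=> + s; elim/last_ind: s g => [|s i IH] g h x Wx.
  by have [c [d _]] := h 1%N; split=> [|i]; [exact: c|exact: d].
rewrite /iter_partial foldr_rcons; apply: IH Wx => k.
by have [_ [_]] := h k.+1; exact.
Qed.

Lemma CkD k n (W : set 'rV[R]_n) f g : open W ->
  Ck k W f -> Ck k W g -> Ck k W (fun x => f x + g x).
Proof.
move=> oW; elim: k f g => [|k IH] f g [cf hf] [cg hg]; split => //.
- by move=> x Wx; exact: (continuousD (cf x Wx) (cg x Wx)).
- by move=> x Wx; exact: (continuousD (cf x Wx) (cg x Wx)).
case: hf => df hf; case: hg => dg hg; split=> [x Wx i|i].
  exact: (derivableD (df x Wx i) (dg x Wx i)).
apply: Ck_eq (IH _ _ (hf i) (hg i)) => // x Wx.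
by rewrite -(deriveD (df x Wx i) (dg x Wx i)).
Qed.

Lemma CkM k n (W : set 'rV[R]_n) f g : open W ->
  Ck k W f -> Ck k W g -> Ck k W (fun x => f x * g x).
Proof.
move=> oW; elim: k f g => [|k IH] f g /[dup] Hf [cf hf] /[dup] Hg [cg hg]; split => //.
- by move=> x Wx; exact: (continuousM (cf x Wx) (cg x Wx)).
- by move=> x Wx; exact: (continuousM (cf x Wx) (cg x Wx)).
case: hf => df hf; case: hg => dg hg; split=> [x Wx i|i].
  exact: (derivableM (df x Wx i) (dg x Wx i)).
apply: Ck_eq (CkD oW (IH _ _ (Ck_pred Hf) (hg i)) (IH _ _ (Ck_pred Hg) (hf i))) => //.
by move=> x Wx; rewrite -[RHS](esym (deriveM (df x Wx i) (dg x Wx i))).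
Qed.

Lemma Ck_cst k n (W : set 'rV[R]_n) c : Ck k W (fun=> c).
Proof.
elim: k c => [|k IH] c; split => //; try by move=> x _; exact: cst_continuous.
split=> [x _ i|i]; first exact: derivable_cst.
rewrite (_ : 'D_(delta_mx 0 i) _ = fun=> 0); first exact: IH.
by apply/funext => x; rewrite derive_cst.
Qed.

Lemma Ck_sum k n (W : set 'rV[R]_n) (I : Type) (s : seq I) (P : pred I) f :
  open W -> (forall i, P i -> Ck k W (f i)) ->
  Ck k W (fun x => \sum_(i <- s | P i) f i x).
Proof.
move=> oW h; elim: s => [|i s IH].
  by rewrite (_ : (fun x => _) = fun=> 0); [exact: Ck_cst|apply/funext => x; rewrite big_nil].
case Pi: (P i).
  rewrite (_ : (fun x => _) = fun x => f i x + \sum_(i <- s | P i) f i x).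
    by apply: CkD => //; exact: h.
  by apply/funext => x; rewrite big_cons Pi.
by rewrite (_ : (fun x => _) = fun x => \sum_(i <- s | P i) f i x)//;
  apply/funext => x; rewrite big_cons Pi.
Qed.

Lemma Ck_prod k n (W : set 'rV[R]_n) (I : Type) (s : seq I) (P : pred I) f :
  open W -> (forall i, P i -> Ck k W (f i)) ->
  Ck k W (fun x => \prod_(i <- s | P i) f i x).
Proof.
move=> oW h; elim: s => [|i s IH].
  by rewrite (_ : (fun x => _) = fun=> 1); [exact: Ck_cst|apply/funext => x; rewrite big_nil].
case Pi: (P i).
  rewrite (_ : (fun x => _) = fun x => f i x * \prod_(i <- s | P i) f i x).
    by apply: CkM => //; exact: h.
  by apply/funext => x; rewrite big_cons Pi.
by rewrite (_ : (fun x => _) = fun x => \prod_(i <- s | P i) f i x)//;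
  apply/funext => x; rewrite big_cons Pi.
Qed.

Lemma CkV k n (W : set 'rV[R]_n) f : open W -> (forall x, W x -> f x != 0) ->
  Ck k W f -> Ck k W (fun x => (f x)^-1).
Proof.
move=> oW f0; elim: k => [|k IH] /[dup] Hf [cf hf]; split => //.
- by move=> x Wx; exact: (continuousV (f0 x Wx) (cf x Wx)).
- by move=> x Wx; exact: (continuousV (f0 x Wx) (cf x Wx)).
case: hf => df hf; split=> [x Wx i|i].
  exact: (derivableV (f0 x Wx) (df x Wx i)).
have I := IH (Ck_pred Hf).
apply: Ck_eq (CkM oW (Ck_cst k W (-1)) (CkM oW (CkM oW I I) (hf i))) => //.
move=> x Wx; rewrite (deriveV (f0 x Wx) (df x Wx i)).
by rewrite mulN1r /GRing.scale /= mulNr expr2 invfM.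
Qed.

Lemma coord_derive n (i j : 'I_n) (x : 'rV[R]_n) :
  is_derive x (delta_mx 0 j) (fun v : 'rV[R]_n => v 0 i) (i == j)%:R.
Proof.
have h : fdiff id (scalar_row (fun v : 'rV[R]_n => v 0 i)) x (col i 1%:M).
  exact/fdiff_coord/fdiff_id.
have := fdiff_derive (delta_mx 0 j) h.
rewrite -rowE !mxE; rewrite eq_sym; by [].
Qed.

Lemma Ck_coord k n (W : set 'rV[R]_n) i : Ck k W (fun v => v 0 i).
Proof.
case: k => [|k]; split => //; try by move=> x _; exact: coord_continuous.
split=> [x _ j|j]; first by have [] := coord_derive i j x.
rewrite (_ : 'D_(delta_mx 0 j) (fun v : 'rV[R]_n => v 0 i) = fun=> (i == j)%:R); first exact: Ck_cst.
by apply/funext => x; have [_] := coord_derive i j x.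
Qed.

Lemma Ck1_fdiff n (W : set 'rV[R]_n) g x k :
  open W -> Ck k.+1 W g -> W x -> fdiff id (scalar_row g) x (grad g x).
Proof.
move=> oW [c [d h]] Wx; apply: (C1_fdiff oW Wx d) => i.
exact: Ck_cont (h i) Wx.
Qed.

(** The chain rule, obtained from [fdiff_comp], writes each partial derivative as a sum of products
    in which only partials of [g], of class one lower, are composed with [h]; hence an induction on
    [k]. *)
Lemma Ck_comp k n m (W : set 'rV[R]_n) (W' : set 'rV[R]_m)
    (h : 'rV[R]_n -> 'rV[R]_m) g :
  open W -> open W' -> (forall x, W x -> W' (h x)) ->
  (forall j, Ck k W (fun x => h x 0 j)) -> Ck k W' g -> Ck k W (fun x => g (h x)).
Proof.
move=> oW oW' hW; elim: k g => [|k IH] g Hh Hg.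
  split=> // x Wx; apply: continuous_comp; last exact: Ck_cont Hg (hW _ Wx).
  by apply: rV_continuous => i; exact: Ck_cont (Hh i) Wx.
have ch x : W x -> {for x, continuous h}.
  by move=> Wx; apply: rV_continuous => i; exact: Ck_cont (Hh i) Wx.
have D x : W x -> forall i, is_derive x (delta_mx 0 i) (fun x => g (h x))
    (\sum_j 'D_(delta_mx 0 i) (fun x => h x 0 j) x * 'D_(delta_mx 0 j) g (h x)).
  move=> Wx i.
  pose A := \matrix_(i, j) 'D_(delta_mx 0 i) (fun x => h x 0 j) x.
  have h1 : fdiff id h x A.
    apply: fdiff_coords => j.
    rewrite (_ : col j A = grad (fun x => h x 0 j) x); last first.
      by apply/colP => l; rewrite !mxE.
    exact: Ck1_fdiff (Hh j) Wx.
  have h2 := fdiff_pull (ch x Wx) (Ck1_fdiff oW' Hg (hW _ Wx)).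
  have := fdiff_derive (delta_mx 0 i) (fdiff_comp h1 h2).
  rewrite mulmxA -rowE mxE => E; congr (is_derive _ _ _ _) : E.
  by apply: eq_bigr => j _; rewrite !mxE.
split.
  move=> x Wx; apply: continuous_comp; first exact: ch.
  exact: Ck_cont Hg (hW _ Wx).
split=> [x Wx i|i]; first by have [] := D x Wx i.
apply: (@Ck_eq _ _ _ (fun x => \sum_j 'D_(delta_mx 0 i) (fun x => h x 0 j) x *
   'D_(delta_mx 0 j) g (h x))) => //.
  by move=> x Wx; have [_ ->] := D x Wx i.
apply: Ck_sum => // j _; apply: CkM => //.
  by have [_ [_]] := Hh j; exact.
apply: (IH ('D_(delta_mx 0 j) g)); first by move=> l; exact: Ck_pred.
by have [_ [_]] := Hg; exact.
Qed.

End Smooth.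

(** * The inverse function theorem *)

(** Supplies the completeness on which the Banach fixed point theorem relies in
    [contraction_solve]. *)
HB.instance Definition _ (R : realType) n := Complete.on 'rV[R]_n.

Section InverseFunction.
Variables (R : realType).

Lemma Ck_det k n m (W : set 'rV[R]_n) (A : 'rV[R]_n -> 'M[R]_m) : open W ->
  (forall i j, Ck k W (fun x => A x i j)) -> Ck k W (fun x => \det (A x)).
Proof.
move=> oW h; apply: Ck_sum => // s _; apply: CkM => //; first exact: Ck_cst.
by apply: Ck_prod.
Qed.

Lemma Ck_invmx k n m (W : set 'rV[R]_n) (A : 'rV[R]_n -> 'M[R]_m) : open W ->
  (forall x, W x -> A x \in unitmx) ->
  (forall i j, Ck k W (fun x => A x i j)) ->
  forall i j, Ck k W (fun x => invmx (A x) i j).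
Proof.
move=> oW uA h i j.
apply: (@Ck_eq _ _ _ _ (fun x => (\det (A x))^-1 * ((-1) ^+ (j + i) *
   \det (row' j (col' i (A x)))))) => //.
  by move=> x Wx; rewrite /invmx uA// !mxE.
apply: CkM => //; last apply: CkM => //.
- apply: CkV => //; last exact: Ck_det.
  by move=> x /uA; rewrite unitmxE unitfE.
- exact: Ck_cst.
apply: Ck_det => // a b.
rewrite (_ : (fun x => _) = (fun x => A x (lift j a) (lift i b)))//.
by apply/funext => x; rewrite !mxE.
Qed.

Lemma reaches_id n (x v : 'rV[R]_n) : reaches id x v.
Proof.
move=> V hV.
have cx : (fun t : R => t *: v + x) @ (0 : R) --> x.
  rewrite -[X in _ --> X](add0r x) -(scale0r v).
  by apply: cvgD; [exact: scalel_continuous|exact: cvg_cst].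
have := cx _ hV; rewrite /= -nbhs_ballE => -[e /= e0 he].
exists e => // t /andP[t0 te]; exists (t *: v + x); last by rewrite addrK.
by apply: he; rewrite -ball_normE /= sub0r normrN ger0_norm.
Qed.

(** Moving by [t *: v] with [v] in the kernel of [J] changes [g] by o(t) only, which the lower bound
    on [g] forbids unless [v = 0]. *)
Lemma lipschitz_unitmx n (g : 'rV[R]_n -> 'rV[R]_n) x (U : set 'rV[R]_n) J :
  nbhs x U -> (forall y, U y -> `|y - x| <= 2 * `|g y - g x|) ->
  fdiff id g x J -> J \in unitmx.
Proof.
move=> hU L hJ; rewrite -row_free_unit; apply: inj_row_free => v vJ.
apply/eqP; rewrite -normr_le0; apply/ler_addgt0Pr => e e0; rewrite add0r.
have e2 : 0 < e / 2 by rewrite divr_gt0.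
have [t [q [t0 Uq /= qx]]] := reaches_fdiff (@reaches_id n x v) hJ hU e2.
rewrite vJ subr0 normrZ normfV (gtr0_norm t0) ler_pdivrMl// => h.
have := L _ Uq; rewrite qx normrZ (gtr0_norm t0) => h2.
by rewrite -(ler_pM2l t0); lra.
Qed.

(** The map sending [x] to [w - phi x] is a contraction of the closed ball of radius [s];
    [|w| < s / 2] puts its values, hence the fixed point, strictly inside. *)
Lemma contraction_solve n (phi : 'rV[R]_n -> 'rV[R]_n) s w : 0 < s ->
  phi 0 = 0 -> (forall x y, `|x| <= s -> `|y| <= s ->
    `|phi y - phi x| <= 2^-1 * `|y - x|) ->
  `|w| < s / 2 -> exists2 x, `|x| < s & x = w - phi x.
Proof.
move=> s0 phi0 L hw.
have L0 x : `|x| <= s -> `|phi x| <= 2^-1 * `|x|.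
  move=> xs; have := L 0 x; rewrite phi0 !subr0 normr0; apply=> //; exact: ltW.
have T x : `|x| <= s -> `|w - phi x| < s.
  by move=> xs; have := L0 x xs; have := ler_normB w (phi x); lra.
pose U := [set x : 'rV[R]_n | `|x| <= s].
have fU : {homo (fun x => w - phi x) : x / U x >-> U x}.
  by move=> x Ux; rewrite /U /=; apply/ltW/T.
have [F EF] := Pfun fU.
have cU : closed U.
  rewrite (_ : U = closed_ball_ [eta Num.norm] 0 s); last first.
    by apply/seteqP; split=> x; rewrite /U /closed_ball_ /= sub0r normrN.
  exact: closed_closed_ball_.
have ctr : is_contraction F.
  have h0 : (0 : R) <= 2^-1 by rewrite invr_ge0.
  exists (NngNum h0); split=> /=; first by lra.
  move=> [x y] [/= Ux Uy]; rewrite -EF.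
  rewrite (_ : w - phi x - _ = phi y - phi x); last by rewrite opprB addrC addrA subrK.
  by rewrite (distrC x); exact: L.
have U0 : U !=set0 by exists 0; rewrite /U /= normr0 ltW.
have [x Ux] := banach_fixed_point ctr cU U0.
by rewrite -EF => Ex; exists x => //; rewrite Ex; apply: T.
Qed.

Theorem inverse_function n (W : set 'rV[R]_n) (g : 'rV[R]_n -> 'rV[R]_n) :
  open W -> W 0 -> g 0 = 0 -> (forall k i, Ck k W (fun x => g x 0 i)) ->
  fdiff id g 0 1%:M ->
  exists W1 W2 h, [/\ open W1, open W2, W1 0, W1 `<=` W &
    [/\ forall x, W1 x -> W2 (g x) /\ h (g x) = x,
      forall y, W2 y -> W1 (h y) /\ g (h y) = y &
      forall k i, Ck k W2 (fun x => h x 0 i)]].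
Proof.
move=> oW W0 g0 Hg Dg.
(* Chosen so that [n%:R * e <= 2^-1]: with partials of [g] this close to those of the identity,
   [mean_value_box] makes [g x - x] half-Lipschitz. *)
pose e : R := (2 * (1 + n%:R))^-1.
have n1 : 0 < 1 + n%:R :> R by rewrite ltr_pwDl.
have e0 : 0 < e by rewrite invr_gt0 mulr_gt0.
have ne : n%:R * e <= 2^-1.
  by rewrite /e invfM mulrCA ler_piMr ?invr_ge0// ler_pdivrMr//; lra.
have D0 i j : 'D_(delta_mx 0 j) (fun x => g x 0 i) 0 = (1%:M : 'M[R]_n) j i.
  have [_ ->] := fdiff_derive (delta_mx 0 j) (fdiff_coord i Dg).
  by rewrite -rowE !mxE.
have : \forall x \near (0 : 'rV[R]_n), W x /\ forall i j,
    `|'D_(delta_mx 0 j) (fun x => g x 0 i) x - (1%:M : 'M[R]_n) j i| <= e.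
  apply: (@filterI _ (nbhs (0 : 'rV[R]_n))); first exact: (open_near oW W0).
  apply: (@filter_forall _ _ _ (nbhs (0 : 'rV[R]_n))) => i.
  apply: (@filter_forall _ _ _ (nbhs (0 : 'rV[R]_n))) => j.
  have [_ [_ /(_ j) [c _]]] := Hg 1%N i.
  have /(@cvgrPdist_le _ _ _ (nbhs (0 : 'rV[R]_n)))/(_ _ e0) := c _ W0.
  by apply: (@filterS _ (nbhs (0 : 'rV[R]_n))) => y; rewrite distrC D0.
move=> /nbhs_ballP[r /= r0 hr].
have ballr (y : 'rV[R]_n) : `|y| < r -> ball (0 : 'rV[R]_n) r y.
  by rewrite -ball_normE /= sub0r normrN.
have rW (y : 'rV[R]_n) : `|y| < r -> W y by move=> /ballr/hr[].
pose phi x := g x - x.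
have Lphi (x y : 'rV[R]_n) : `|x| < r -> `|y| < r -> `|phi y - phi x| <= 2^-1 * `|y - x|.
  move=> xr yr; apply: rV_norm_le => [|i]; first by rewrite mulr_ge0// invr_ge0.
  have H z : `|z - 0| < r -> forall j, derivable (fun x => g x 0 i) z (delta_mx 0 j) /\
     `|'D_(delta_mx 0 j) (fun x => g x 0 i) z - (col i 1%:M : 'cV[R]_n) j 0| <= e.
    rewrite subr0 => zr j; split.
      by have [_ [d _]] := Hg 1%N i; apply: d; exact: rW.
    by rewrite mxE; have [_] := hr _ (ballr _ zr); apply.
  have := @mean_value_box _ _ (fun x => g x 0 i) 0 r (col i 1%:M) e (ltW e0) H x y.
  rewrite !subr0 => /(_ xr yr).
  rewrite colE mul1mx -colE => h.
  rewrite (_ : _ 0 i = g y 0 i - g x 0 i - (col i (y - x)) 0 0); last first.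
    by rewrite /phi !mxE; ring.
  by apply: le_trans h _; rewrite ler_wpM2r.
have Lg (x y : 'rV[R]_n) : `|x| < r -> `|y| < r -> `|y - x| <= 2 * `|g y - g x|.
  move=> xr yr; have := Lphi x y xr yr.
  rewrite (_ : phi y - phi x = (g y - g x) - (y - x)); last first.
    by apply/rowP => i; rewrite /phi !mxE; ring.
  by have := lerB_dist (y - x) (g y - g x); rewrite (distrC (y - x)); lra.
pose s := r / 2; have s0 : 0 < s by rewrite divr_gt0.
have sr (x : 'rV[R]_n) : `|x| <= s -> `|x| < r by rewrite /s; lra.
have sol (w : 'rV[R]_n) : `|w| < s / 2 -> exists2 x : 'rV[R]_n, `|x| < s & g x = w.
  have p0 : phi 0 = 0 by rewrite /phi g0 subrr.
  have Ls x y : `|x| <= s -> `|y| <= s -> `|phi y - phi x| <= 2^-1 * `|y - x|.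
    by move=> xs ys; apply: Lphi; exact: sr.
  move=> ws; have [x xs E] := contraction_solve s0 p0 Ls ws.
  exists x => //; rewrite -(subrK x (g x)) -/(phi x) addrC [X in X + _]E.
  by rewrite subrK.
(* Outside the ball of radius [s / 2] the inverse gets the default value 0. *)
have /choice[h hP] : forall w : 'rV[R]_n, exists x : 'rV[R]_n, `|w| < s / 2 -> `|x| < s /\ g x = w.
  move=> w; case: (ltP `|w| (s / 2)) => [/sol[x ? ?]|_]; first by exists x.
  by exists 0.
pose W1 := [set x : 'rV[R]_n | `|x| < s /\ `|g x| < s / 2].
pose W2 := [set x : 'rV[R]_n | `|x| < s / 2].
have cg x : W x -> {for x, continuous g}.
  by move=> Wx; apply: rV_continuous => i; exact: Ck_cont (Hg 0%N i) Wx.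
have bn c (x : 'rV[R]_n) : `|x| < c -> \forall y \near x, `|y| < c.
  move=> xc; have := nbhsx_ballx x (c - `|x|); rewrite subr_gt0 => /(_ xc).
  apply: (@filterS _ (nbhs x)) => y; rewrite -ball_normE /= => xy.
  by have := ler_normB x (x - y); rewrite opprB addrC subrK; lra.
have oW2 : open W2 by rewrite openE => x; exact: bn.
have oW1 : open W1.
  rewrite openE => x [xs gx]; have h1 := bn _ _ xs.
  have h2 := cg x (rW _ (sr _ (ltW xs))) _ (bn _ _ gx).
  exact: (@filterI _ (nbhs x) _ _ _ h1 h2).
have hK (y : 'rV[R]_n) : W2 y -> W1 (h y) /\ g (h y) = y.
  by move=> Wy; have [hs E] := hP _ Wy; rewrite /W1 /= E.
have gK (x : 'rV[R]_n) : W1 x -> W2 (g x) /\ h (g x) = x.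
  move=> [xs gx]; split=> //; have [hs E] := hP _ gx.
  apply/eqP; rewrite -subr_eq0 -normr_le0.
  by have := Lg x (h (g x)) (sr _ (ltW xs)) (sr _ (ltW hs)); rewrite E subrr normr0; lra.
have Lh (y z : 'rV[R]_n) : W2 y -> W2 z -> `|h z - h y| <= 2 * `|z - y|.
  move=> /hK[[ys _] Ey] /hK[[zs _] Ez]; have := Lg (h y) (h z).
  by rewrite Ey Ez; apply; apply/sr/ltW.
have ch (y : 'rV[R]_n) : W2 y -> {for y, continuous h}.
  move=> Wy; apply/(@cvgrPdist_le _ _ _ (nbhs y)) => d d0.
  have d2 : 0 < d / 2 by rewrite divr_gt0.
  have H : nbhs y ((fun z : 'rV[R]_n => `|y - z| <= d / 2) `&` W2).
    have H1 := near_dist y d2; have H2 := open_near oW2 Wy.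
    exact: (@filterI _ (nbhs y) _ _ _ H1 H2).
  have sub : (fun z : 'rV[R]_n => `|y - z| <= d / 2) `&` W2 `<=` [set z : 'rV[R]_n | `|h y - h z| <= d].
    move=> z [/= hz Wz]; rewrite distrC.
    by apply: le_trans (Lh _ _ Wy Wz) _; rewrite distrC; lra.
  exact: (@filterS _ (nbhs y) _ _ _ sub H).
pose J x := \matrix_(i, j) 'D_(delta_mx 0 i) (fun x => g x 0 j) x.
have DJ x : W x -> fdiff id g x (J x).
  move=> Wx; apply: fdiff_coords => j.
  rewrite (_ : col j (J x) = grad (fun x => g x 0 j) x); last first.
    by apply/colP => l; rewrite !mxE.
  exact: Ck1_fdiff (Hg 1%N j) Wx.
have UJ x : `|x| < r -> J x \in unitmx.
  move=> xr; apply: (lipschitz_unitmx (bn _ _ xr) _ (DJ x (rW _ xr))) => y yr.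
  exact: Lg.
have Wh y : W2 y -> `|h y| < r by move=> /hK[[/ltW/sr]].
have Dh y : W2 y -> fdiff id h y (invmx (J (h y))).
  (* Pulled back by [h], the expansion of [g] is one of [g \o h], the identity near [y], with
     respect to [h]; [fdiff_inv] exchanges the two. *)
  move=> Wy; apply: fdiff_inv; first exact/UJ/Wh.
  have := fdiff_pull (ch y Wy) (DJ _ (rW _ (Wh _ Wy))).
  apply: fdiff_eq; have := open_near oW2 Wy.
  by apply: (@filterS _ (nbhs y)) => z /hK[].
have Dhi y i j : W2 y ->
    is_derive y (delta_mx 0 i) (fun x => h x 0 j) (invmx (J (h y)) i j).
  move=> Wy; have := fdiff_derive (delta_mx 0 i) (fdiff_coord j (Dh y Wy)).
  by rewrite -rowE !mxE.
exists W1, W2, h; split=> //; first by split; rewrite ?g0 normr0// divr_gt0.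
  by move=> x [/ltW/sr/rW].
split=> // k.
(* Bootstrap: the partials of [h] are entries of [invmx (J (h y))], of class C^k as soon as [h] is,
   so that [h] is of class C^(k+1). *)
elim: k => [|k IH] i.
  split=> // x Wx; exact/coord_near/ch.
split; first by move=> x Wx; exact/coord_near/ch.
split; first by move=> x Wx j; have [] := Dhi x j i Wx.
move=> j.
apply: (@Ck_eq _ _ _ _ (fun y => invmx (J (h y)) j i)) => //.
  by move=> x Wx; have [_ ->] := Dhi x j i Wx.
apply: Ck_invmx => // [x /Wh/UJ//|a b].
rewrite (_ : (fun x => _) = fun x => 'D_(delta_mx 0 a) (fun x => g x 0 b) (h x)).
  apply: (@Ck_comp _ _ _ _ _ W h ('D_(delta_mx 0 a) (fun x => g x 0 b))) => //; first by move=> x /Wh/rW.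
  by have [_ [_]] := Hg k.+1 b; exact.
by apply/funext => x; rewrite mxE.
Qed.

End InverseFunction.

(** * Charts of manifolds with corners *)

Section ChartCalculus.
Variables (R : realType) (X : topologicalType) (n : nat).
Implicit Types (c : chart R X n) (p : X).

Lemma chart_reaches c p v : chart_ok c -> cdom c p ->
  (forall t, 0 <= t -> sector (cbd c) (c p + t *: v)) -> reaches c p v.
Proof.
move=> [oD _ _ hV] Dp hv V /nbhs_interior nV.
have oV' : open (V° `&` cdom c) by apply: openI => //; exact: open_interior.
have Vp : (V° `&` cdom c) p by split=> //; exact: nbhs_singleton nV.
have [W oW E] := hV _ oV' (@subIsetr _ _ _).
have Wp : W (c p) by have [] : (W `&` sector (cbd c)) (c p) by rewrite -E; exists p.
have [e e0 he] := @reaches_id _ _ (c p) v _ (open_near oW Wp).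
exists e => // t te; have [y Wy Ey] := he t te.
have Ey' : y = c p + t *: v by rewrite -Ey addrC subrK.
have : (W `&` sector (cbd c)) y.
  by split=> //; rewrite Ey'; apply: hv; case/andP: te.
rewrite -E => -[q [Vq _] cq]; exists q; first exact: interior_subset Vq.
by rewrite cq Ey' addrC addKr.
Qed.

Lemma chart_sector c p : chart_ok c -> cdom c p -> sector (cbd c) (c p).
Proof.
move=> [oD _ _ hV] Dp; have [W _ E] := hV _ oD (@subset_refl _ _).
by have [] : (W `&` sector (cbd c)) (c p) by rewrite -E; exists p.
Qed.

Lemma sectorD (B : {set 'I_n}) (v w : 'rV[R]_n) : sector B v -> sector B w -> sector B (v + w).
Proof. by move=> hv hw i iB; rewrite mxE addr_ge0//; [exact: hv|exact: hw]. Qed.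

Lemma sectorZ (B : {set 'I_n}) (t : R) (v : 'rV[R]_n) : 0 <= t -> sector B v -> sector B (t *: v).
Proof. by move=> t0 hv i iB; rewrite mxE mulr_ge0//; exact: hv. Qed.

Lemma sector_delta (B : {set 'I_n}) i : sector B (delta_mx 0 i : 'rV[R]_n).
Proof. by move=> j _; rewrite mxE ler0n. Qed.

Lemma chart_reaches_sector c p v : chart_ok c -> cdom c p ->
  sector (cbd c) v -> reaches c p v.
Proof.
move=> okc Dp hv; apply: chart_reaches => // t t0; apply: sectorD.
  exact: chart_sector.
exact: sectorZ.
Qed.

Lemma chart_fdiff_unique c p m (F : X -> 'rV[R]_m) A B : chart_ok c -> cdom c p ->
  fdiff c F p A -> fdiff c F p B -> A = B.
Proof.
move=> okc Dp; apply: fdiff_unique => i.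
by apply: chart_reaches_sector => //; exact: sector_delta.
Qed.

Lemma chart_cont c p : chart_ok c -> cdom c p -> {for p, continuous c}.
Proof. by case=> _ _ h _; exact: h. Qed.

Lemma chart_near c p : chart_ok c -> cdom c p -> nbhs p (cdom c).
Proof. by case=> oD _ _ _; exact: open_near. Qed.

Lemma local_rep_fdiff (Y : topologicalType) c (F : Y -> X) f (p : Y) W g :
  chart_ok c -> cdom c (F p) -> {for p, continuous F} ->
  local_rep c F f p W g -> fdiff (c \o F) (scalar_row f) p (grad g (c (F p))).
Proof.
move=> okc DF cF [oW Wp sg fg].
have h := Ck1_fdiff oW (smooth_Ck sg 1%N) Wp.
have cc : {for p, continuous (c \o F)}.
  by apply: continuous_comp => //; exact: chart_cont.
apply: fdiff_eq (fdiff_pull cc h).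
by apply: filterS fg => q E; apply/rowP => i; rewrite !mxE.
Qed.

Lemma smooth_in_fdiff c f p : chart_ok c -> cdom c p -> smooth_in c f p ->
  exists a, fdiff c (scalar_row f) p a.
Proof.
move=> okc Dp [W [g h]]; exists (grad g (c p)).
exact: (local_rep_fdiff (F := id) okc Dp (fun P h => h) h).
Qed.

Lemma smooth_in_rV c m (F : X -> 'rV[R]_m) p :
  (forall i, smooth_in c (fun q => F q 0 i) p) ->
  exists (W : set 'rV[R]_n) (h : 'rV[R]_n -> 'rV[R]_m), [/\ open W, W (c p), forall k i, Ck k W (fun v => h v 0 i) &
     \forall q \near p, F q = h (c q)].
Proof.
move=> /choice[W /choice[g H]].
exists [set v | forall i, W i v], (fun v => \row_i g i v); split.
- rewrite openE => v hv; apply: (@filter_forall _ _ _ (nbhs v)) => i.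
  by have [oWi _ _ _] := H i; exact: (open_near oWi (hv i)).
- by move=> i; have [] := H i.
- move=> k i; apply: (@Ck_sub _ _ _ _ (W i)); first by move=> v; exact.
  rewrite (_ : (fun v => _) = g i); last by apply/funext => v; rewrite mxE.
  by have [_ _ /smooth_Ck] := H i.
have : \forall q \near p, forall i, F q 0 i = g i (c q).
  by apply: filter_forall => i; have [_ _ _] := H i.
by apply: filterS => q E; apply/rowP => i; rewrite mxE.
Qed.

Lemma Ck_rV_cont k m (W : set 'rV[R]_n) (h : 'rV[R]_n -> 'rV[R]_m) v :
  (forall i, Ck k W (fun v => h v 0 i)) -> W v -> {for v, continuous h}.
Proof. by move=> H Wv; apply: rV_continuous => i; exact: Ck_cont (H i) Wv. Qed.

Lemma open_preim m (W : set 'rV[R]_n) (W' : set 'rV[R]_m) (h : 'rV[R]_n -> 'rV[R]_m) :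
  open W -> open W' -> (forall v, W v -> {for v, continuous h}) ->
  open [set v | W v /\ W' (h v)].
Proof.
move=> oW oW' ch; rewrite openE => v [Wv Wv'].
have h1 := open_near oW Wv.
have h2 := ch v Wv _ (open_near oW' Wv').
exact: (@filterI _ (nbhs v) _ _ _ h1 h2).
Qed.

Lemma smooth_in_comp c m (F : X -> 'rV[R]_m) p W' G :
  {for p, continuous c} -> (forall i, smooth_in c (fun q => F q 0 i) p) ->
  open W' -> W' (F p) -> (forall k, Ck k W' G) ->
  smooth_in c (fun q => G (F q)) p.
Proof.
move=> cc /smooth_in_rV[W [h [oW Wp sh Fh]]] oW' W'p sG.
have Fp : F p = h (c p) := nbhs_singleton Fh.
have oW2 := open_preim oW oW' (fun v => Ck_rV_cont (sh 0%N)).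
exists [set v | W v /\ W' (h v)], (fun v => G (h v)); split => //.
- by rewrite /= -Fp.
- apply: Ck_smooth => k.
  apply: (@Ck_comp _ _ _ _ _ W' h G) => //; first by move=> x [].
  by move=> j; apply: (@Ck_sub _ _ _ _ W) => // v [].
- by apply: filterS Fh => q ->.
Qed.

Lemma smooth_in_near c f f' p : (\forall q \near p, f q = f' q) ->
  smooth_in c f p -> smooth_in c f' p.
Proof.
move=> E [W [g [oW Wp sg fg]]]; exists W, g; split=> //.
by apply: filterS2 E fg => q <-.
Qed.

End ChartCalculus.

Section ChartChange.
Variables (R : realType) (M : mfd R).
Notation n := (mdim M).

(** The only source of new adapted charts: a local diffeomorphism [g] of the model space, matching
    the sector of [c] with that of [B'], is composed with [c]. It serves for translations to nearby
    points, linear changes of the y's and the linearizing chart. *)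
Lemma chart_change (c : chart R M n) p (U : set M) (W W' : set 'rV[R]_n)
    (g h : 'rV[R]_n -> 'rV[R]_n) (B' : {set 'I_n}) :
  coords c -> cdom c p -> open U -> U p ->
  open W -> open W' -> W (c p) -> g (c p) = 0 ->
  (forall v, W v -> W' (g v) /\ h (g v) = v) ->
  (forall w, W' w -> W (h w) /\ g (h w) = w) ->
  (forall k i, Ck k W (fun v => g v 0 i)) ->
  (forall k i, Ck k W' (fun v => h v 0 i)) ->
  (forall v, W v -> sector (cbd c) v <-> sector B' (g v)) ->
  exists c' : chart R M n, [/\ adapted p c', cbd c' = B',
    forall q, cdom c' q -> [/\ U q, cdom c q & W (c q)] & cmap c' = g \o c].
Proof.
move=> [okc compc] Dp oU Up oW oW' Wp gp0 gK hK sg sh sec.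
have [oD inj ccont cV] := okc.
have cg v : W v -> {for v, continuous g} by move=> Wv; exact: Ck_rV_cont (sg 0%N) Wv.
have ch v : W' v -> {for v, continuous h} by move=> Wv; exact: Ck_rV_cont (sh 0%N) Wv.
have oUD : open (U `&` cdom c) by exact: openI.
have [W0 oW0 E0] := cV _ oUD (@subIsetr _ _ _).
have W0p : W0 (c p) by have [] : (W0 `&` sector (cbd c)) (c p) by rewrite -E0; exists p.
have W'0 : W' 0 by rewrite -gp0; have [] := gK _ Wp.
have h0 : h 0 = c p by rewrite -gp0; have [] := gK _ Wp.
have oW0h : open [set w | W' w /\ W0 (h w)] by exact: open_preim.
have W0h : [set w | W' w /\ W0 (h w)] 0 by rewrite /= h0.
(* For [|w| < e] the point [h w] lies in [W0], so if [w] is in the sector it comes from a point of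
   [U]. Restricting the domain to [|g (c q)| < e] therefore makes the image exactly a corner box. *)
have /nbhs_ballP[e /= e0 he] := open_near oW0h W0h.
have be w : `|w| < e -> W' w /\ W0 (h w).
  by move=> we; apply: he; rewrite -ball_normE /= sub0r normrN.
pose D := [set q | [/\ U q, cdom c q, W (c q) & `|g (c q)| < e]].
pose c' := Chart D B' (g \o c).
have cgc q : D q -> {for q, continuous (g \o c)}.
  by move=> [_ Dq Wq _]; apply: continuous_comp; [exact: ccont|exact: cg].
have oD' : open D.
  rewrite openE => q Dq; have [Uq cq Wq gq] := Dq.
  have n1 := open_near oUD (conj Uq cq).
  have n2 := ccont _ cq _ (open_near oW Wq).
  have n3 : \forall x \near q, `|g (c x)| < e.
    have := cgc q Dq; move/(@cvgrPdist_lt _ _ _ (nbhs q)).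
    have e1 : 0 < e - `|g (c q)| by rewrite subr_gt0.
    move/(_ _ e1); apply: filterS => x /= hx.
    have := ler_normB (g (c q)) (g (c q) - g (c x)).
    by rewrite opprB addrC subrK; lra.
  by apply: filterS3 n1 n2 n3 => x [? ?] ? ?; split.
have okc' : chart_ok c'.
  split=> [//|||].
  - move=> q q' [_ Dq Wq _] [_ Dq' Wq' _] E; apply: inj => //.
    by rewrite -(gK _ Wq).2 -(gK _ Wq').2; congr h.
  - by move=> q Dq; exact: (cgc q Dq).
  move=> V oV VD.
  have VD' : V `<=` cdom c by move=> q /VD[].
  have [W1 oW1 E1] := cV _ oV VD'.
  exists [set w | W' w /\ (W1 `&` W) (h w)].
    by apply: open_preim => //; exact: openI.
  apply/seteqP; split=> [_ [q Vq <-]|w [[W'w [W1w _]] sw]].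
    have [Uq Dq Wq _] := VD q Vq; have [W'q hq] := gK _ Wq.
    have [W1q sq] : (W1 `&` sector (cbd c)) (c q) by rewrite -E1; exists q.
    by split; [split=> //; rewrite hq|exact/sec].
  have [Ww ghw] := hK _ W'w.
  have : (W1 `&` sector (cbd c)) (h w) by split=> //; apply/sec => //; rewrite ghw.
  by rewrite -E1 => -[q Vq E]; exists q => //=; rewrite E.
exists c'; split=> //; last by move=> q [].
split.
- split=> // c'' c''a q [Uq Dq Wq gq] D''q.
  have [s1 s2] := compc c'' c''a q Dq D''q; split=> i.
    have [W3 [g3 [oW3 W3q sg3 E3]]] := s1 i.
    have [W'q hq] := gK _ Wq.
    exists [set w | W' w /\ W3 (h w)], (fun w => g3 (h w)); split.
    + exact: open_preim.
    + by rewrite /= hq.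
    + apply: Ck_smooth => k; apply: (@Ck_comp _ _ _ _ _ W3 h g3) => //.
      * exact: open_preim.
      * by move=> x [].
      * by move=> j; apply: (@Ck_sub _ _ _ _ W') => // v [].
      * exact: smooth_Ck.
    have : nbhs q D by apply: open_near.
    by apply: filterS2 E3 => x -> [_ _ Wx _]; rewrite /= (gK _ Wx).2.
  have [_ /(_ _ c''a) ok'' _ _ _] := mfdP M.
  exact: (smooth_in_comp (chart_cont ok'' D''q) s2 oW Wq (fun k => sg k i)).
- by split=> //; rewrite gp0 normr0.
- by rewrite /= gp0.
exists e => //; apply/seteqP; split=> [_ [q [Uq Dq Wq gq] <-]|w [sw we]].
  split; last by move=> i; apply: le_lt_trans gq; exact: rV_norm_ge.
  by apply/sec => //; exact: chart_sector.
have wn : `|w| < e by exact: rV_norm_lt.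
have [W'w W0w] := be _ wn; have [Ww ghw] := hK _ W'w.
have : (W0 `&` sector (cbd c)) (h w) by split=> //; apply/sec => //; rewrite ghw.
rewrite -E0 => -[q [Uq Dq] E]; exists q; last by rewrite /= E.
by split; rewrite ?E ?ghw.
Qed.

End ChartChange.

(** * Differentials of the structural maps *)

Section Idempotents.
Variable R : realType.

Lemma idempotent_factor_mx n r (C C' : 'M[R]_(n, r)) (D D' : 'M[R]_(r, n)) :
  D' *m C = 1%:M -> D *m C' = 1%:M -> (C *m D) *m (C *m D) = C *m D ->
  D *m C = 1%:M.
Proof.
move=> DC CD /(congr1 (mulmx D')) /(congr1 (mulmxr C')) /=.
by rewrite !mulmxA DC !mul1mx -!mulmxA CD mulmx1 => ->.
Qed.

(** A rank factorization [Y = C *m D] of an idempotent satisfies [D *m C = 1%:M], so the trace is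
    the rank. *)
Lemma idempotent_trace0 n (Y : 'M[R]_n) : Y *m Y = Y -> \tr Y = 0 -> Y = 0.
Proof.
move=> YY tY; set C := col_base Y; set D := row_base Y.
have E : C *m D = Y := mulmx_base Y.
have [D' DC] : exists D', D' *m C = 1%:M by apply/row_fullP; exact: col_base_full.
have [C' CD] : exists C', D *m C' = 1%:M by apply/row_freeP; exact: row_base_free.
have DC1 : D *m C = 1%:M by apply: idempotent_factor_mx DC CD _; rewrite E.
move: tY; rewrite -E mxtrace_mulC DC1 mxtrace1 => /eqP.
by rewrite pnatr_eq0 mxrank_eq0 => /eqP Y0; rewrite E.
Qed.

Lemma idempotent_trace n (X : 'M[R]_n) : X *m X = X -> \tr X = n%:R -> X = 1%:M.
Proof.
move=> XX tX; apply/esym/eqP; rewrite -subr_eq0; apply/eqP/idempotent_trace0.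
  by rewrite mulmxBl mul1mx mulmxBr mulmx1 XX subrr subr0.
by rewrite raddfB /= tX mxtrace1 subrr.
Qed.

End Idempotents.

Section SmoothMaps.
Variable R : realType.
Implicit Types M : mfd R.

Lemma atlas_coords M (c : chart R M (mdim M)) : atlas c -> coords c.
Proof.
move=> ac; have [_ ok comp _ _] := mfdP M.
by split=> [|c' ac']; [exact: ok|exact: comp].
Qed.

Lemma chart_at M (p : M) : exists2 c : chart R M (mdim M), coords c & cdom c p.
Proof.
have [_ _ _ /(_ p)[c ac Dp] _] := mfdP M.
by exists c => //; exact: atlas_coords.
Qed.

Lemma smooth_map_fdiff M1 M2 (F : M1 -> M2) p c1 c2 : smooth_map F ->
  coords c1 -> cdom c1 p -> coords c2 -> cdom c2 (F p) ->
  exists A : 'M[R]_(mdim M1, mdim M2), fdiff c1 (c2 \o F) p A.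
Proof.
move=> [_ sF] co1 D1 co2 D2.
have /choice[a ha] := fun i => smooth_in_fdiff co1.1 D1 (sF p c1 c2 co1 D1 co2 D2 i).
exists (\matrix_(i, j) a j i 0); apply: fdiff_coords => i.
rewrite (_ : col i _ = a i); last by apply/colP => j; rewrite !mxE.
exact: ha.
Qed.

End SmoothMaps.

Section Functor.
Variables (R : realType) (M : gproduct R).

Lemma gmap_smooth n m (I : 'I_n.+1 -> 'I_m.+1) : smooth_map (gmap (g := M) I).
Proof. by have [[]] := gmap_interior M I. Qed.

Lemma gmap_cont n m (I : 'I_n.+1 -> 'I_m.+1) : continuous (gmap (g := M) I).
Proof. by have [] := gmap_smooth I. Qed.

(* The matrix of the differential at p of gmap a, read in the chart c; it is
   only meaningful when gmap a fixes p. *)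
Definition gdiff k (c : chart R (M k.+1) (mdim (M k.+1))) (p : M k.+1)
    (a : 'I_k.+1 -> 'I_k.+1) : 'M[R]_(mdim (M k.+1)) :=
  xget 0 [set A | fdiff c (c \o gmap (g := M) a) p A].

Section AtPoint.
Variables (k : nat) (c : chart R (M k.+1) (mdim (M k.+1))) (p : M k.+1).
Hypotheses (co : coords c) (Dp : cdom c p).
Implicit Types a b : 'I_k.+1 -> 'I_k.+1.

Lemma gdiffP a : gmap (g := M) a p = p -> fdiff c (c \o gmap (g := M) a) p (gdiff c p a).
Proof.
move=> ap; have Da : cdom c (gmap (g := M) a p) by rewrite ap.
have [A hA] := smooth_map_fdiff (gmap_smooth a) co Dp co Da.
exact: (xgetPex 0 (ex_intro _ A hA)).
Qed.

Lemma gdiff_eq a A : gmap (g := M) a p = p ->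
  fdiff c (c \o gmap (g := M) a) p A -> gdiff c p a = A.
Proof. by move=> /gdiffP h; exact: (chart_fdiff_unique co.1 Dp). Qed.

Lemma gdiff_comp a b : gmap (g := M) a p = p -> gmap (g := M) b p = p ->
  gdiff c p (a \o b) = gdiff c p a *m gdiff c p b.
Proof.
move=> ap bp; apply: gdiff_eq; first by rewrite gmap_comp ap.
have h : fdiff c (c \o gmap (g := M) b) (gmap (g := M) a p) (gdiff c p b).
  by rewrite ap; exact: gdiffP.
have := fdiff_comp (gdiffP ap) (fdiff_pull (@gmap_cont _ _ a p) h).
by apply: fdiff_eq; apply: nearW => q /=; rewrite gmap_comp.
Qed.

(** The differential factors as [B *m A] through a tangent space of the smaller space, with
    [A *m B = 1%:M] because [I \o s = id]; the trace is invariant under exchange of the factors. *)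
Lemma gdiff_trace n (I : 'I_k.+1 -> 'I_n.+1) (s : 'I_n.+1 -> 'I_k.+1) :
  cancel s I -> gmap (g := M) (s \o I) p = p ->
  \tr (gdiff c p (s \o I)) = (mdim (M n.+1))%:R.
Proof.
move=> sK sIp; set p' := gmap (g := M) s p.
have Ip' : gmap (g := M) I p' = p by rewrite -gmap_comp.
have [c' co' Dp'] := chart_at p'.
have Dp2 : cdom c (gmap (g := M) I p') by rewrite Ip'.
have [B hB] := smooth_map_fdiff (gmap_smooth s) co Dp co' Dp'.
have [A hA] := smooth_map_fdiff (gmap_smooth I) co' Dp' co Dp2.
have -> : gdiff c p (s \o I) = B *m A.
  apply: gdiff_eq => //.
  have := fdiff_comp hB (fdiff_pull (@gmap_cont _ _ s p) hA).
  by apply: fdiff_eq; apply: nearW => q /=; rewrite gmap_comp.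
rewrite mxtrace_mulC (_ : A *m B = 1%:M) ?mxtrace1//.
apply: (chart_fdiff_unique co'.1 Dp' _ (fdiff_id c' p')).
have hB' : fdiff c (c' \o gmap (g := M) s) (gmap (g := M) I p') B by rewrite Ip'.
have := fdiff_comp hA (fdiff_pull (@gmap_cont _ _ I p') hB').
apply: fdiff_eq; apply: nearW => q /=; rewrite -gmap_comp.
by rewrite (_ : I \o s = id) ?gmap_id//; apply/funext.
Qed.

End AtPoint.

Lemma idempotent_factor k (e : 'I_k.+1 -> 'I_k.+1) : e \o e = e ->
  exists n (I : 'I_k.+1 -> 'I_n.+1) (s : 'I_n.+1 -> 'I_k.+1),
    [/\ cancel s I, s \o I = e & n.+1 = #|e @: [set: 'I_k.+1]|%SET].
Proof.
move=> ee; set A := (e @: [set: 'I_k.+1])%SET.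
have eA i : e i \in A by apply: imset_f.
have [n An] : exists n, #|A| = n.+1.
  by case E: #|A| => [|n]; [move: (eA ord0); rewrite (cards0_eq E) inE|exists n].
exists n, (fun i => cast_ord An (enum_rank_in (eA ord0) (e i))),
  (fun j => enum_val (cast_ord (esym An) j)); split => //.
- move=> j; apply: (canLR (cast_ordKV _)).
  set x := cast_ord _ j.
  have /imsetP[i _ E] : enum_val x \in A by exact: enum_valP.
  have -> : e (enum_val x) = enum_val x by rewrite E -[e (e i)]/((e \o e) i) ee.
  exact: enum_valK_in.
by apply/funext => i /=; rewrite cast_ordK enum_rankK_in.
Qed.

Lemma gdiff_idempotent_trace k (c : chart R (M k.+1) (mdim (M k.+1))) p e n :
  coords c -> cdom c p -> e \o e = e -> gmap (g := M) e p = p ->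
  #|e @: [set: 'I_k.+1]|%SET = n.+1 ->
  \tr (gdiff c p e) = (gmu M + n%:Z * gkappa M)%:~R.
Proof.
move=> co Dp ee ep En; have [n' [I [s [sK E En']]]] := idempotent_factor ee.
have nn : n = n' by apply: succn_inj; rewrite -En.
subst n'.
by rewrite -gdim -E gdiff_trace ?E.
Qed.

End Functor.

(** * Boundary faces and interior b-maps *)

Section Boundary.
Variable R : realType.
Implicit Types M : mfd R.

Lemma smooth_in_cont M (c : chart R M (mdim M)) f (p : M) :
  {for p, continuous c} -> smooth_in c f p -> {for p, continuous f}.
Proof.
move=> cc [W [g [oW Wp sg fg]]].
have cgc : {for p, continuous (g \o c)}.
  by apply: continuous_comp => //; exact: (Ck_cont (smooth_Ck sg 0%N) Wp).
have fp : f p = g (c p) := nbhs_singleton fg.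
move: cgc; rewrite /prop_for /continuous_at /= -fp; apply: cvg_trans.
by apply: near_eq_cvg; apply: filterS fg => q ->.
Qed.

Lemma smooth_fun_cont M (f : M -> R) : smooth_fun f -> continuous f.
Proof.
move=> sf p; have [c co Dp] := chart_at p.
exact: smooth_in_cont (chart_cont co.1 Dp) (sf p c co Dp).
Qed.

(** A boundary defining function vanishing on an open set would have zero differential there, at
    points of its own hypersurface. *)
Lemma bdf_neq0 M (H : set M) x (O : set M) q : bdf H x -> open O -> O q ->
  exists2 q', O q' & x q' != 0.
Proof.
move=> [bH sx x0 HE dx] oO Oq; apply: contrapT => nex.
have z q' : O q' -> x q' = 0.
  by move=> Oq'; apply/eqP; apply: contra_notT nex => xq'; exists q'.
have Hq : H q by rewrite HE /=; exact: z.
have [c [W [g [co Dq rep [i /negP]]]]] := dx q Hq; apply.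
have h1 := local_rep_fdiff (F := id) co.1 Dq (fun P h => h) rep.
have h2 : fdiff c (scalar_row x) q 0.
  have := fdiff_cst c (0 : 'rV[R]_1) q; apply: fdiff_eq.
  have := open_near oO Oq; apply: filterS => q' /z xq'.
  by apply/rowP => j; rewrite !mxE xq'.
have /colP/(_ i) := chart_fdiff_unique co.1 Dq h1 h2.
by rewrite !mxE => ->.
Qed.

Lemma bdfs_neq0 M N (x : 'I_N -> M -> R) (O : set M) q :
  (forall k, exists H, bdf H (x k)) -> open O -> O q ->
  exists2 q', O q' & forall k, x k q' != 0.
Proof.
move=> bx oO Oq.
suff [q' Oq' h] : exists2 q', O q' & forall k, k \in enum 'I_N -> x k q' != 0.
  by exists q' => // k; apply: h; rewrite mem_enum.
elim: (enum 'I_N) O q oO Oq => [|k s IH] O q oO Oq; first by exists q.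
have [H bH] := bx k; have [q1 Oq1 xq1] := bdf_neq0 bH oO Oq.
have cx : continuous (x k) by case: bH => _ /smooth_fun_cont.
have oO1 : open (O `&` (x k @^-1` [set y | y != 0])).
  apply: openI => //; apply: open_comp; first by move=> y _; exact: cx.
  exact: open_neq.
have [q2 [Oq2 xq2] h] := IH _ q1 oO1 (conj Oq1 xq1).
by exists q2 => // j; rewrite inE => /predU1P[->//|]; exact: h.
Qed.

Section Face.
Variables (M : mfd R) (p : M) (c : chart R M (mdim M)) (i : 'I_(mdim M)).
Hypotheses (ac : adapted p c) (iB : i \in cbd c).
Notation n := (mdim M).

(** The open face of the i-th boundary coordinate: positivity of the other boundary coordinates
    makes its points of codimension one. *)
Let face : set M := [set q | [/\ cdom c q, c q 0 i = 0 &
  forall j, j \in cbd c -> j != i -> 0 < c q 0 j]].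

Let co : coords c. Proof. by case: ac. Qed.

Let ones : 'rV[R]_n := \row_j ((j \in cbd c) && (j != i))%:R.

Let ones_sector : sector (cbd c) ones.
Proof. by move=> j _; rewrite mxE ler0n. Qed.

Lemma face_codim1 : face `<=` @codim1_points R M.
Proof.
move=> q [Dq qi qj].
(* Inside [W] only the i-th inequality of the sector is a constraint, so translating [c] by its
   value at [q] leaves [i] as the sole boundary coordinate. *)
pose W := [set v : 'rV[R]_n | forall j, j \in cbd c -> j != i -> 0 < v 0 j].
pose W' := [set v : 'rV[R]_n | forall j, j \in cbd c -> j != i -> 0 < v 0 j + c q 0 j].
have oW : open W.
  rewrite openE => v Wv; apply: (@filter_forall _ _ _ (nbhs v)) => j.
  have [jB|/negP jB] := boolP (j \in cbd c); last by apply: nearW.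
  have [ji|/negP ji] := boolP (j != i); last by apply: nearW.
  have := @coord_continuous _ _ _ 0 j v _ (open_near (@open_gt _ 0) (Wv j jB ji)).
  by apply: (@filterS _ (nbhs v)).
have oW' : open W'.
  rewrite (_ : W' = (fun v => v + c q) @^-1` W).
    apply: open_comp => // v _.
    by apply: (@continuousD _ _ _ id (fun=> c q)); [exact: cvg_id|exact: cst_continuous].
  by apply/seteqP; split=> v hv j jB ji; have := hv j jB ji; rewrite ?mxE.
have [|||||c' [ac' bc' _ _]] := @chart_change _ M c q setT W W' (fun v => v - c q)
   (fun v => v + c q) [set i]%SET co Dq openT I oW oW' qj (subrr _).
- move=> v Wv; rewrite subrK; split=> // j jB ji.
  by rewrite !mxE subrK; exact: Wv.
- move=> v Wv; rewrite addrK; split=> // j jB ji.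
  by rewrite !mxE; exact: Wv.
- move=> k j; rewrite (_ : (fun v => _) = fun v : 'rV[R]_n => v 0 j + - c q 0 j).
    by apply: CkD => //; [exact: Ck_coord|exact: Ck_cst].
  by apply/funext => v; rewrite !mxE.
- move=> k j; rewrite (_ : (fun v => _) = fun v : 'rV[R]_n => v 0 j + c q 0 j).
    by apply: CkD => //; [exact: Ck_coord|exact: Ck_cst].
  by apply/funext => v; rewrite !mxE.
- move=> v Wv; split=> [sv j|sv j jB].
    by rewrite inE => /eqP ->; rewrite !mxE qi subr0; exact: sv.
  have [->|ji] := eqVneq j i; last exact/ltW/Wv.
  by have := sv i; rewrite inE eqxx !mxE qi subr0; exact.
by exists c' => //; rewrite bc' cards1.
Qed.

(** The image of an adapted chart is a corner box, hence convex: the segment between the two images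
    is pulled back to the manifold. *)
Lemma face_segment q0 q1 : face q0 -> face q1 ->
  exists2 B : set M, connected B & [/\ B q0, B q1 & B `<=` face].
Proof.
move=> [D0 i0 j0] [D1 i1 j1]; have [_ _ _ [e e0 img]] := ac.
have box q : cdom c q -> corner_box (cbd c) e (c q) by move=> Dq; rewrite -img; exists q.
pose line (t : R) := (1 - t) *: c q0 + t *: c q1.
have line_box t : 0 <= t <= 1 -> corner_box (cbd c) e (line t).
  move=> /andP[t0 t1]; have [s0 b0] := box _ D0; have [s1 b1] := box _ D1.
  split=> [|j].
    by apply: sectorD; apply: sectorZ => //; rewrite subr_ge0.
  rewrite !mxE; apply: le_lt_trans (ler_normD _ _) _; rewrite !normrM.
  rewrite (ger0_norm t0) (ger0_norm (x := 1 - t)) ?subr_ge0//.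
  have := b0 j; have := b1 j; move: (normr_ge0 (c q0 0 j)) (normr_ge0 (c q1 0 j)).
  move: `|c q0 0 j| `|c q1 0 j| => a b a0 bb be ae.
  have [->|t01] := eqVneq t 0; first by lra.
  have : 0 < t by rewrite lt_neqAle eq_sym t01.
  by nra.
have /choice[f hf] : forall t : R, exists q, 0 <= t <= 1 -> cdom c q /\ c q = line t.
  move=> t; case: (pselect (0 <= t <= 1)) => [/line_box|nt]; last by exists q0 => /nt.
  by rewrite -img => -[q Dq E]; exists q.
have [okc _] := co; have [oD inj _ cV] := okc.
have f0 : f 0 = q0.
  have [|D E] := hf 0; first by rewrite lexx ler01.
  by apply: inj => //; rewrite E /line subr0 scale1r scale0r addr0.
have f1 : f 1 = q1.
  have [|D E] := hf 1; first by rewrite lexx ler01.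
  by apply: inj => //; rewrite E /line subrr scale1r scale0r add0r.
have cline : continuous line.
  move=> t; apply: cvgD; last exact: scalel_continuous.
  apply: (@continuous_comp _ _ _ (fun t : R => 1 - t) (fun t : R => t *: c q0)).
    by apply: cvgB; [exact: cvg_cst|exact: cvg_id].
  exact: scalel_continuous.
exists (f @` `[0, 1]).
  apply: connected_continuous_connected; first exact: segment_connected.
  apply/subspace_continuousP => t; rewrite /= in_itv /= => t01 V /nbhs_interior nV.
  have [Dt Et] := hf t t01.
  have oV' : open (V° `&` cdom c) by apply: openI => //; exact: open_interior.
  have [W oW EW] := cV _ oV' (@subIsetr _ _ _).
  have Wt : W (line t).
    have [] : (W `&` sector (cbd c)) (line t) by rewrite -EW; exists (f t) => //; split=> //; exact: nbhs_singleton nV.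
    by [].
  have := cline t _ (open_near oW Wt); rewrite /= => hW.
  rewrite /within /=; move: hW; apply: (@filterS _ (nbhs t)) => s Ws; rewrite in_itv /= => s01.
  have [Ds Es] := hf s s01.
  have : (W `&` sector (cbd c)) (line s) by split=> //; have [] := line_box s s01.
  rewrite -EW => -[q [Vq Dq] Eq].
  have fs : f s = q by apply: inj => //; rewrite Es.
  by rewrite /from_subspace /= fs; exact: interior_subset Vq.
split; [exists 0 => //|exists 1 => //|].
- by rewrite /= in_itv /= lexx ler01.
- by rewrite /= in_itv /= lexx ler01.
move=> _ [t + <-]; rewrite /= in_itv /= => t01; have [Dt Et] := hf t t01.
split=> //; first by rewrite Et !mxE i0 i1 !mulr0 addr0.
move=> j jB ji; rewrite Et !mxE; have := j0 j jB ji; have := j1 j jB ji.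
case/andP: t01 => t0 t1; move: (c q0 0 j) (c q1 0 j) => a b b0 a0.
have [->|t01] := eqVneq t 0; first by lra.
have : 0 < t by rewrite lt_neqAle eq_sym t01.
by nra.
Qed.

Lemma face_nonempty : exists q, face q.
Proof.
have [_ _ _ [e e0 img]] := ac.
have : corner_box (cbd c) e ((e / 2) *: ones).
  split=> [|j]; first by apply: sectorZ => //; rewrite divr_ge0// ltW.
  rewrite !mxE; case: (_ && _); rewrite ?mulr1 ?mulr0 ?normr0//.
  by rewrite gtr0_norm ?divr_gt0//; lra.
rewrite -img => -[q Dq E]; exists q; split=> //.
  by rewrite E !mxE eqxx andbF mulr0.
by move=> j jB ji; rewrite E !mxE jB ji mulr1 divr_gt0.
Qed.

(** The open face lies in a single component of the codimension one points, whose closure is a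
    hypersurface. A small step along [ones] goes from any point with zero i-th coordinate into the
    open face, so such points lie in that closure. *)
Lemma boundary_face_bdf : exists H x, bdf H x /\
  forall q, cdom c q -> c q 0 i = 0 -> x q = 0.
Proof.
have [q0 Fq0] := face_nonempty.
pose H := closure (connected_component (@codim1_points R M) q0).
have bH : bhypersurface H by exists q0 => //; exact: face_codim1.
have [_ _ _ _ /(_ H bH)[x bx]] := mfdP M.
exists H, x; split=> // q Dq qi.
suff : H q by case: bx => _ _ _ -> _.
have FH : face `<=` connected_component (@codim1_points R M) q0.
  move=> q1 Fq1; have [B cB [Bq0 Bq1 BF]] := face_segment Fq0 Fq1.
  apply: (connected_component_max Bq0 _ cB) => //.
  exact: subset_trans BF face_codim1.
apply: closure_subset FH _ _ => V nV.
have nVD : nbhs q (V `&` cdom c) by apply: filterI => //; exact: chart_near co.1 Dq.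
have [e e0 he] := chart_reaches_sector co.1 Dq ones_sector nVD.
have [|q' [Vq' Dq'] Eq'] := he (e / 2); first by apply/andP; split; lra.
have {}Eq' : c q' = c q + (e / 2) *: ones by rewrite -Eq' addrC subrK.
exists q'; split=> //; split=> //.
  by rewrite Eq' !mxE qi eqxx andbF mulr0 addr0.
move=> j jB ji; rewrite Eq' !mxE jB ji mulr1.
by have := chart_sector co.1 Dq jB; lra.
Qed.

End Face.

(** Otherwise the pullback of a defining function of the face would vanish on an open set, although
    it is a positive function times powers of boundary defining functions, which are simultaneously
    nonzero at some point of that set. *)
Lemma interior_bmap_face M1 M2 (F : M1 -> M2) p (c : chart R M2 (mdim M2)) i :
  interior_bmap F -> adapted (F p) c -> i \in cbd c ->
  ~ \forall q \near p, c (F q) 0 i = 0.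
Proof.
move=> [[[cF _] bF] iF] ac iB Z.
have [H [x [bx hx]]] := boundary_face_bdf ac iB.
have [co Dp _ _] := ac.
have [h|[al [N [y [a [_ al0 by_ Ey]]]]]] := bF H x bx; first exact: iF bx h.
have /nbhs_interior nO : \forall q \near p, x (F q) = 0.
  have h1 : nbhs p (F @^-1` cdom c) by apply: cF; exact: chart_near co.1 Dp.
  by apply: filterS2 Z h1 => q Zq Dq; apply: hx.
have [q Oq yq] := bdfs_neq0 by_ (open_interior _) (nbhs_singleton nO).
have := interior_subset Oq; rewrite /= -[x (F q)]/((x \o F) q) Ey => /eqP.
rewrite mulf_eq0 gt_eqF//= => /prodf_eq0[k _].
by rewrite expf_eq0 (negbTE (yq k)) andbF.
Qed.

End Boundary.

(** * Tangent cones and the boundary of a diagonal *)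

Section TangentCones.
Variables (R : realType).

Lemma reaches_fdiff_eq0 (T : topologicalType) n m (u : T -> 'rV[R]_n)
    (F : T -> 'rV[R]_m) p A (v : 'rV[R]_n) V :
  reaches u p v -> fdiff u F p A -> nbhs p V ->
  (forall q t, V q -> 0 < t -> u q - u p = t *: v -> F q = F p) -> v *m A = 0.
Proof.
move=> r h hV H; apply/eqP; rewrite -normr_le0; apply/ler_addgt0Pr => e e0.
rewrite add0r; have [t [q [t0 Vq uq]]] := reaches_fdiff r h hV e0.
by rewrite (H q t)// subrr scaler0 sub0r normrN.
Qed.

Lemma fdiff_sector (T : topologicalType) n m (u : T -> 'rV[R]_n)
    (F : T -> 'rV[R]_m) p A (v : 'rV[R]_n) (B : {set 'I_m}) :
  reaches u p v -> fdiff u F p A -> F p = 0 ->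
  (\forall q \near p, sector B (F q)) -> sector B (v *m A).
Proof.
move=> r h Fp sF j jB; apply/ler_addgt0Pr => e e0.
have [t [q [t0 sq _ hq]]] := reaches_fdiff r h sF e0.
have := le_trans (rV_norm_ge _ j) hq; rewrite Fp subr0 !mxE => {}hq.
have := sq j jB; have : 0 <= t^-1 * F q 0 j by rewrite mulr_ge0 ?invr_ge0 ?(ltW t0)//; exact: sq.
move: hq; rewrite ler_norml => /andP[_]; move: (\sum_ _ _) => x; lra.
Qed.

Lemma sector_eq0 n (B : {set 'I_n}) (v : 'rV[R]_n) :
  (forall j, j \in B -> v 0 j = 0) <-> sector B v /\ sector B (- v).
Proof.
split=> [h|[h1 h2] j jB].
  by split=> j jB; rewrite ?mxE h// oppr0.
apply/eqP; rewrite eq_le h1// andbT -oppr_ge0.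
by have := h2 j jB; rewrite mxE.
Qed.

(** The directions tangent to the corner are those [v] with both [v] and [- v] in the sector, and a
    differential maps sector to sector. *)
Lemma fdiff_sector_eq0 (T : topologicalType) n m (u : T -> 'rV[R]_n)
    (F : T -> 'rV[R]_m) p A (v : 'rV[R]_n) (B : {set 'I_n}) (B' : {set 'I_m}) :
  (forall w, sector B w -> reaches u p w) -> fdiff u F p A -> F p = 0 ->
  (\forall q \near p, sector B' (F q)) ->
  (forall j, j \in B -> v 0 j = 0) -> forall j, j \in B' -> (v *m A) 0 j = 0.
Proof.
move=> r h Fp sF /sector_eq0[v1 v2]; apply/sector_eq0; split.
  exact: (fdiff_sector (r _ v1) h).
by rewrite -mulNmx; exact: (fdiff_sector (r _ v2) h).
Qed.

End TangentCones.

Section ProductChart.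
Variables (R : realType) (X : topologicalType) (n : nat).
Variables (c : chart R X n) (p : X).
Hypotheses (okc : chart_ok c) (Dp : cdom c p) (cp0 : c p = 0).

Lemma chart_small e : 0 < e -> \forall q \near p, `|c q| < e.
Proof.
move=> e0; have /(@cvgrPdist_lt _ _ _ (nbhs p))/(_ _ e0) := chart_cont okc Dp.
by apply: filterS => q; rewrite cp0 sub0r normrN.
Qed.

(** A product of at least two coordinates vanishes to second order at the corner. *)
Lemma fdiff_prod_coords (J : {set 'I_n}) a b : a \in J -> b \in J -> a != b ->
  fdiff c (scalar_row (fun q => \prod_(i in J) c q 0 i)) p (0 : 'cV[R]_n).
Proof.
move=> aJ bJ ab e e0.
have P0 : \prod_(i in J) c p 0 i = 0.
  by apply/eqP/prodf_eq0; exists a => //; rewrite cp0 mxE.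
apply: filterS2 (chart_small e0) (chart_small ltr01) => q qe q1.
rewrite mulmx0 subr0 cp0 subr0; apply: rV_norm_le => [|i].
  by rewrite mulr_ge0// ltW.
rewrite !mxE P0 subr0 (bigD1 a)//= (bigD1 b)/=; last by rewrite bJ eq_sym.
set P := (X in _ * (_ * X)); have h1 : `|P| <= 1.
  rewrite normr_prod; apply: prodr_ile1 => j _; rewrite normr_ge0/=.
  by apply: le_trans (ltW q1); exact: rV_norm_ge.
have h2 : `|c q 0 a| <= e by apply: le_trans (ltW qe); exact: rV_norm_ge.
rewrite normrM; apply: ler_pM => //.
rewrite normrM -[leRHS]mulr1; apply: ler_pM => //; exact: rV_norm_ge.
Qed.

End ProductChart.

Section BoundaryProjection.
Variables (R : realType) (M : gproduct R).

(** In b-fibration coordinates for the map of [s], the section given by [I] forces every index set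
    [J j] to be a singleton, and the p-submanifold property of its range forces these singletons to
    exhaust the boundary coordinates at [p]. *)
Lemma boundary_projection n k (I : 'I_k.+1 -> 'I_n.+1) (s : 'I_n.+1 -> 'I_k.+1)
    (p : M k.+1) :
  cancel s I -> gmap (g := M) (s \o I) p = p ->
  exists2 c : chart R (M k.+1) (mdim (M k.+1)), adapted p c &
    forall q b, b \in cbd c -> cdom c q -> cdom c (gmap (g := M) (s \o I) q) ->
      c (gmap (g := M) (s \o I) q) 0 b = c q 0 b.
Proof.
move=> sK sIp; set p' := gmap (g := M) s p.
have Ip' : gmap (g := M) I p' = p by rewrite -gmap_comp.
have sI x : gmap (g := M) s (gmap (g := M) I x) = x.
  by rewrite -gmap_comp (_ : I \o s = id) ?gmap_id//; apply/funext.
have [_ _ /(_ p)[c1 [c2 [a1 a2 c12 [_ [J [_ _ Jdisj HJ]]]]]]] := gmap_inj M (can_inj sK).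
have [co1 D1 c1p [e1 e10 img1]] := a1; have [co2 D2 c2p _] := a2.
have Dp2 : cdom c1 (gmap (g := M) I p') by rewrite Ip'.
have [Phi hPhi] := smooth_map_fdiff (gmap_smooth M s) co1 D1 co2 D2.
have [Psi hPsi] := smooth_map_fdiff (gmap_smooth M I) co2 D2 co1 Dp2.
have PP : Psi *m Phi = 1%:M.
  apply: (chart_fdiff_unique co2.1 D2 _ (fdiff_id c2 p')).
  have h : fdiff c1 (c2 \o gmap (g := M) s) (gmap (g := M) I p') Phi by rewrite Ip'.
  have := fdiff_comp hPsi (fdiff_pull (@gmap_cont _ _ _ _ I p') h).
  by apply: fdiff_eq; apply: nearW => q /=; rewrite sI.
have colPhi j : j \in cbd c2 -> fdiff c1 (scalar_row (fun q => \prod_(i in J j) c1 q 0 i)) p (col j Phi).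
  move=> jB; have [_ HJj] := HJ j jB.
  have := fdiff_coord j hPhi; apply: fdiff_eq.
  have := chart_near co1.1 D1; apply: filterS => q Dq.
  by apply/rowP => l; rewrite !mxE /= HJj.
(* An empty product would be 1 where the coordinate is 0; two or more factors would make column [j]
   of [Phi] zero, against [Psi *m Phi = 1%:M]. *)
have J1 j : j \in cbd c2 -> exists2 i, i \in cbd c1 & J j = [set i]%SET.
  move=> jB; have [JB HJj] := HJ j jB.
  have [J0|[i iJ]] := set_0Vmem (J j).
    have := HJj p D1; rewrite J0 big_set0 -/p' c2p mxE => /esym/eqP.
    by rewrite oner_eq0.
  exists i; first by move/fintype.subsetP: JB; apply.
  apply/eqP; rewrite finset.eqEsubset finset.sub1set iJ andbT; apply/fintype.subsetP => i' i'J.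
  rewrite inE; apply: contraT => ii'.
  have z := fdiff_prod_coords co1.1 D1 c1p i'J iJ ii'.
  have /colP Z := chart_fdiff_unique co1.1 D1 (colPhi j jB) z.
  have := congr1 (fun A : 'M[R]__ => A j j) PP; rewrite !mxE eqxx big1 => [/esym/eqP|l _].
    by rewrite oner_eq0.
  by have := Z l; rewrite !mxE => ->; rewrite mulr0.
have PhiE j i l : j \in cbd c2 -> J j = [set i]%SET -> Phi l j = (l == i)%:R.
  move=> jB Ji.
  have h : fdiff c1 (scalar_row (fun q => \prod_(i in J j) c1 q 0 i)) p (col i 1%:M).
    have := fdiff_coord i (fdiff_id c1 p); apply: fdiff_eq; apply: nearW => q.
    by rewrite Ji; apply/rowP => x; rewrite !mxE big_set1.
  have /colP/(_ l) := chart_fdiff_unique co1.1 D1 (colPhi j jB) h.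
  by rewrite !mxE.
(* If [i] is missed, a vector [w] tangent to the diagonal is built whose only nonzero boundary
   coordinate is the i-th. It is fixed by [Phi *m Psi], but its image by [Phi], hence [w] itself, is
   tangent to the corner. *)
have onto i : i \in cbd c1 -> exists2 j, j \in cbd c2 & J j = [set i]%SET.
  move=> iB; apply: contrapT => nex.
  have [[_ [_ psub]] _ _ _] := gmap_surj M (fun j => ex_intro (fun i => I i = j) (s j) (sK j)).
  have [c [A [ac HA]]] := psub p (ex_intro2 _ _ p' Logic.I Ip').
  have [co Dc cp _] := ac.
  (* A boundary coordinate among the equations of the range would pull back to zero near [p'], which
     an interior b-map excludes. *)
  have Adisj a : a \in A -> a \notin cbd c.
    move=> aA; apply/negP => aB.
    have ac' : adapted (gmap (g := M) I p') c by rewrite Ip'.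
    apply: (interior_bmap_face (gmap_interior M I) ac' aB).
    have : nbhs p' (gmap (g := M) I @^-1` cdom c).
      by apply: gmap_cont; rewrite Ip'; exact: chart_near co.1 Dc.
    apply: filterS => q Dq; have [+ _] := HA _ Dq; by apply.
  have idf (c' c'' : chart R (M k.+1) (mdim (M k.+1))) : coords c' -> coords c'' -> cdom c' p ->
      cdom c'' p -> exists T, fdiff c' c'' p T.
    move=> o' o'' D' D''.
    have Di : cdom c'' (gmap (g := M) (@id 'I_k.+1) p) by rewrite gmap_id.
    have [T hT] := smooth_map_fdiff (gmap_smooth M (@id 'I_k.+1)) o' D' o'' Di.
    by exists T; apply: fdiff_eq hT; apply: nearW => q /=; rewrite gmap_id.
  have [T hT] := idf _ _ co1 co D1 Dc; have [T' hT'] := idf _ _ co co1 Dc D1.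
  have TT : T *m T' = 1%:M.
    exact: (chart_fdiff_unique co1.1 D1 (fdiff_comp hT hT') (fdiff_id c1 p)).
  have r1 w : sector (cbd c1) w -> reaches c1 p w by exact: (chart_reaches_sector co1.1 D1).
  have r w : sector (cbd c) w -> reaches c p w by exact: (chart_reaches_sector co.1 Dc).
  have r2 w : sector (cbd c2) w -> reaches c2 p' w by exact: (chart_reaches_sector co2.1 D2).
  have nsec (X : topologicalType) d (c' : chart R X d) x : chart_ok c' -> cdom c' x ->
      \forall q \near x, sector (cbd c') (c' q).
    by move=> ok' D'; have := chart_near ok' D'; apply: filterS => q; exact: chart_sector.
  pose v := (delta_mx 0 i : 'rV[R]_(mdim (M k.+1))) *m T.
  have sv : sector (cbd c) v.
    apply: (fdiff_sector (r1 _ _) hT cp (nsec _ _ _ _ co.1 Dc)); exact: sector_delta.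
  (* Dropping the coordinates in [A] makes the vector tangent to the diagonal without touching its
     boundary coordinates. *)
  pose v' := \row_j (if j \in A then 0 else v 0 j).
  have v'E j : j \in cbd c -> v' 0 j = v 0 j.
    by move=> jB; rewrite mxE ifN//; apply: contraL jB => /Adisj.
  have sv' : sector (cbd c) v' by move=> j jB; rewrite v'E//; exact: sv.
  pose w := v' *m T'.
  have wB b : b \in cbd c1 -> w 0 b = (b == i)%:R.
    move=> bB.
    have sub_row (x y : 'rV[R]_(mdim (M k.+1))) j : x 0 j = y 0 j -> (x - y) 0 j = 0.
      by move=> E; rewrite !mxE E subrr.
    have d0 j : j \in cbd c -> (v' - v) 0 j = 0.
      by move=> /v'E; exact: sub_row.
    have := fdiff_sector_eq0 r hT' c1p (nsec _ _ _ _ co1.1 D1) d0 bB.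
    rewrite mulmxBl -/w /v -mulmxA TT mulmx1 !mxE eqxx /= => /eqP.
    by rewrite subr_eq0 => /eqP ->; rewrite eq_sym.
  have wE : w *m (Phi *m Psi) = w.
    have h : fdiff c1 (c1 \o gmap (g := M) (s \o I)) p (Phi *m Psi).
      have := fdiff_comp hPhi (fdiff_pull (@gmap_cont _ _ _ _ s p) hPsi).
      by apply: fdiff_eq; apply: nearW => q /=; rewrite gmap_comp.
    have := reaches_fdiff_eq0 (r _ sv') (fdiff_comp hT' (fdiffB h (fdiff_id c1 p))) (chart_near co.1 Dc).
    rewrite mulmxA mulmxBr mulmx1 -/w => H; apply/eqP; rewrite -subr_eq0; apply/eqP/H.
    move=> q t Dq t0; rewrite cp subr0 => cq /=; rewrite sIp subrr.
    have [_ [|q' _ <-]] := HA q Dq.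
      by move=> a aA; rewrite cq !mxE aA mulr0.
    by rewrite gmap_comp sI subrr.
  have wPhi j : j \in cbd c2 -> (w *m Phi) 0 j = 0.
    move=> jB; have [a aB Ja] := J1 j jB.
    rewrite mxE (bigD1 a)//= (PhiE j a a)// eqxx mulr1 big1 => [|l la].
      rewrite addr0 wB//; case: eqP => // ai.
      by case: nex; exists j => //; rewrite Ja ai.
    by rewrite (PhiE j a l)// (negbTE la) mulr0.
  have c1Ip : (c1 \o gmap (g := M) I) p' = 0 by rewrite /= Ip'.
  have nI : \forall q \near p', sector (cbd c1) ((c1 \o gmap (g := M) I) q).
    have h : nbhs (gmap (g := M) I p') [set x | sector (cbd c1) (c1 x)].
      by rewrite Ip'; exact: (nsec _ _ _ _ co1.1 D1).
    exact: (gmap_cont h).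
  have := fdiff_sector_eq0 r2 hPsi c1Ip nI wPhi iB.
  rewrite -mulmxA wE wB// eqxx => /eqP; by rewrite oner_eq0.
exists c1 => // q b bB Dq Dq'.
have [j jB Jj] := onto b bB; have [_ HJj] := HJ j jB.
have := HJj _ Dq; have := HJj _ Dq'; rewrite Jj !big_set1 => <- <-.
by rewrite gmap_comp sI.
Qed.

End BoundaryProjection.

(** * Partitions and diagonals *)

Local Notation pblock := finset.pblock.
Local Notation partition := finset.partition.
Local Notation preim_partition := finset.preim_partition.
Local Notation cover := finset.cover.
Local Notation trivIset := finset.trivIset.

Section Partitions.
Variable k : nat.
Implicit Types (P Q : {set {set 'I_k.+1}}) (a e r : 'I_k.+1 -> 'I_k.+1).
Implicit Types (b : 'I_k.+1) (B : {set 'I_k.+1}).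

Definition has_kernel e P : Prop :=
  forall i j, (e i == e j) = (pblock P i == pblock P j).

Definition refines P Q : Prop :=
  forall i j, pblock P i = pblock P j -> pblock Q i = pblock Q j.

Definition link P Q : rel 'I_k.+1 :=
  [rel i j | (pblock P i == pblock P j) || (pblock Q i == pblock Q j)].

Lemma kernel_preim (T : eqType) (f : 'I_k.+1 -> T) i j :
  (pblock (preim_partition f [set: 'I_k.+1]) i ==
   pblock (preim_partition f [set: 'I_k.+1]) j)%SET = (f i == f j).
Proof.
set D := [set: 'I_k.+1]%SET.
have eqv : {in D & &, equivalence_rel [rel x y | f x == f y]}.
  by split=> //= /eqP->.
have cov : cover (preim_partition f D) = D.
  exact: cover_partition (preim_partitionP _ _).
have tI : trivIset (preim_partition f D).
  by have /and3P[] := preim_partitionP f D.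
rewrite eq_pblock ?cov ?inE//.
exact: (pblock_equivalence_partition eqv).
Qed.

Lemma preim_kernel (T : eqType) (f : 'I_k.+1 -> T) P :
  partition P [set: 'I_k.+1]%SET ->
  (forall i j, (f i == f j) = (pblock P i == pblock P j)) ->
  preim_partition f [set: 'I_k.+1]%SET = P.
Proof.
move=> pP fP.
rewrite -[RHS](preim_partition_pblock pP).
by apply: eq_imset => x; apply/setP => y; rewrite !inE fP.
Qed.

(** Each block gets the common value of [r] on it if this value lies in the block, and otherwise an
    arbitrary point [rep] of the block. The first choice makes [e] fix the image of [r]. *)
Lemma partition_idempotent r P : r \o r = r ->
  (forall i j, pblock P i = pblock P j -> r i = r j) ->
  exists e, [/\ e \o e = e, has_kernel e P & e \o r = r].
Proof.
move=> rr rP; pose rep i := odflt i [pick j | pblock P j == pblock P i].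
have repP i : pblock P (rep i) = pblock P i.
  by rewrite /rep; case: pickP => [j /eqP//|/(_ i)]; rewrite eqxx.
have rep_eq i j : pblock P i = pblock P j -> rep i = rep j.
  by rewrite /rep => ->; case: pickP => [//|/(_ j)]; rewrite eqxx.
pose e i := if pblock P (r i) == pblock P i then r i else rep i.
have eP i : pblock P (e i) = pblock P i by rewrite /e; case: eqP.
have e_eq i j : pblock P i = pblock P j -> e i = e j.
  by move=> ij; rewrite /e (rP _ _ ij) ij (rep_eq _ _ ij).
exists e; split.
- by apply/funext => i /=; apply: e_eq.
- move=> i j; apply/eqP/eqP => [eij|]; last exact: e_eq.
  by rewrite -(eP i) eij eP.
- by apply/funext => i; rewrite /= /e -[r (r i)]/((r \o r) i) rr eqxx.
Qed.

Lemma join_partition P Q : exists2 J, partition J [set: 'I_k.+1]%SET &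
  forall i j, (pblock J i == pblock J j) = connect (link P Q) i j.
Proof.
have sym : connect_sym (link P Q).
  by apply: sym_connect_sym => i j; rewrite /link /= (eq_sym (pblock P i)) (eq_sym (pblock Q i)).
have eqv : {in [set: 'I_k.+1]%SET & &, equivalence_rel (connect (link P Q))}.
  move=> x y z _ _ _; split=> [|xy]; first exact: connect0.
  by apply/idP/idP; apply: connect_trans => //; rewrite sym.
exists (equivalence_partition (connect (link P Q)) [set: 'I_k.+1]%SET).
  exact: equivalence_partitionP.
move=> i j; have pE := equivalence_partitionP eqv.
have /and3P[_ tI _] := pE.
rewrite eq_pblock ?(cover_partition pE) ?inE//.
exact: (pblock_equivalence_partition eqv).
Qed.

Definition collapse b (B : {set 'I_k.+1}) i := if i \in B then b else i.

Lemma collapse_idem b (B : {set 'I_k.+1}) : b \in B -> collapse b B \o collapse b B = collapse b B.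
Proof.
by move=> bB; apply/funext => i; rewrite /= /collapse; case iB: (i \in B); rewrite ?bB ?iB.
Qed.

Lemma single_preim b (B : {set 'I_k.+1}) : b \in B ->
  single_partition B = preim_partition (collapse b B) [set: 'I_k.+1]%SET.
Proof.
move=> bB; have E x : [set y in [set: 'I_k.+1] | collapse b B x == collapse b B y]%SET =
    if x \in B then B else [set x]%SET.
  apply/setP => y; rewrite !inE /collapse /=; case: ifP => xB.
    case: ifP => yB; first by rewrite eqxx.
    by apply/negP => /eqP by_; rewrite -by_ bB in yB.
  case: ifP => yB; rewrite inE.
    by rewrite !(introF eqP)// => E; [rewrite -E yB in xB|rewrite E bB in xB].
  by rewrite eq_sym.
apply/setP => X; rewrite !inE; apply/idP/imsetP.
  case/orP => [/eqP->|/imsetP[x xB ->]].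
    by exists b; rewrite ?inE// E bB.
  by exists x; rewrite ?inE// E; move: xB; rewrite inE => /negbTE ->.
move=> [x _ ->]; rewrite E; case: ifP => xB; first by rewrite eqxx.
by rewrite imset_f ?orbT// inE xB.
Qed.

Lemma single_partitionP b (B : {set 'I_k.+1}) : b \in B ->
  partition (single_partition B) [set: 'I_k.+1]%SET.
Proof. by move=> /single_preim ->; exact: preim_partitionP. Qed.

Lemma single_kernel b (B : {set 'I_k.+1}) : b \in B -> has_kernel (collapse b B) (single_partition B).
Proof. by move=> /single_preim E i j; rewrite E kernel_preim. Qed.

Lemma single_pblock (B : {set 'I_k.+1}) i j : i \in B -> j \in B ->
  pblock (single_partition B) i = pblock (single_partition B) j.
Proof.
by move=> iB jB; apply/eqP; rewrite -(single_kernel iB) /collapse iB jB.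
Qed.

Lemma single_refines (B : {set 'I_k.+1}) P : (exists b, b \in B) ->
  (forall i j, i \in B -> j \in B -> pblock P i = pblock P j) ->
  refines (single_partition B) P.
Proof.
move=> [b bB] h i j /eqP; rewrite -(single_kernel bB) /collapse.
case: ifP => iB; case: ifP => jB /eqP; first by move=> _; exact: h.
- by move=> E; rewrite -E bB in jB.
- by move=> E; rewrite E bB in iB.
- by move=> ->.
Qed.

End Partitions.

(** * Intersections of diagonals *)

Section DiagonalCalculus.
Variables (R : realType) (M : gproduct R) (k : nat).
Implicit Types (P Q : {set {set 'I_k.+1}}) (a e : 'I_k.+1 -> 'I_k.+1) (q : M k.+1).

Lemma diag_fixed P a q : diag P q -> (forall i, pblock P (a i) = pblock P i) ->
  gmap (g := M) a q = q.
Proof.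
move=> [n [I [_ <- [q' _ <-]]]] aP; rewrite -gmap_comp; congr (gmap _ q').
by apply/funext => i; apply/eqP; rewrite /= -(kernel_preim I) aP.
Qed.

Lemma diag_idempotent P e q : partition P [set: 'I_k.+1]%SET ->
  e \o e = e -> has_kernel e P -> diag P q <-> gmap (g := M) e q = q.
Proof.
move=> pP ee eP; split=> [dq|eq].
  apply: diag_fixed dq _ => i; apply/eqP; rewrite -eP.
  by rewrite -[e (e i)]/((e \o e) i) ee.
have [n [I [s [sK sI _]]]] := idempotent_factor ee.
exists n, I; split.
- by move=> j; exists (s j); rewrite sK.
- apply: preim_kernel => // i j; rewrite -eP -sI /=.
  by rewrite (inj_eq (can_inj sK)).
- by exists (gmap (g := M) s q) => //; rewrite -gmap_comp sI.
Qed.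

Lemma diag_refines P Q q : partition P [set: 'I_k.+1]%SET ->
  refines P Q -> diag Q q -> diag P q.
Proof.
move=> pP PQ dq; pose z := (fun=> ord0) : 'I_k.+1 -> 'I_k.+1.
have [//|e [ee eP _]] := @partition_idempotent k z P erefl.
apply/(diag_idempotent _ pP ee eP); apply: diag_fixed dq _ => i.
by apply: PQ; apply/eqP; rewrite -eP -[e (e i)]/((e \o e) i) ee.
Qed.

(* Among the maps of J(k) fixing q and preserving the blocks of J, one of
   minimal rank has has_kernel J: if two points of its image were linked, composing
   with a map moving one a step towards the other would lower the rank. *)
Lemma diag_join P Q J q : partition J [set: 'I_k.+1]%SET ->
  refines P J -> refines Q J ->
  (forall i j, pblock J i = pblock J j -> connect (link P Q) i j) ->
  diag P q -> diag Q q -> diag J q.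
Proof.
move=> pJ PJ QJ JPQ dP dQ.
pose stab (w : {ffun 'I_k.+1 -> 'I_k.+1}) :=
  `[< gmap (g := M) w q = q /\ forall i, pblock J (w i) = pblock J i >].
pose im (w : {ffun 'I_k.+1 -> 'I_k.+1}) := (w @: [set: 'I_k.+1])%SET.
have sid : stab (finfun id).
  apply/asboolP; split=> [|i]; last by rewrite ffunE.
  by rewrite (_ : (finfun id : _ -> _) = id) ?gmap_id//; apply/funext => i; rewrite ffunE.
case: (@arg_minnP _ (finfun id) stab (fun w => #|im w|) sid) => w sw mw.
(* Induction along a path of links from [x] to [y], over all [w'] of minimal rank. The map [u] moves
   [x] to the next point [z]; the induction hypothesis gives [z = y], so the new image omits [x] and
   is too small. *)
have key s : forall (w' : {ffun 'I_k.+1 -> 'I_k.+1}) x y, stab w' ->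
    (#|im w'| <= #|im w|)%N -> x \in im w' -> y \in im w' ->
    path (link P Q) x s -> last x s = y -> x = y.
  elim: s => [|z s IH] w' x y sw' mw' xw yw //= /andP[xz zs] ly.
  apply: contrapT => /eqP xy.
  pose u l := if l == x then z else l.
  have uP : gmap (g := M) u q = q /\ forall i, pblock J (u i) = pblock J i.
    case/orP: xz => /eqP xz; split.
    - by apply: diag_fixed dP _ => i; rewrite /u; case: eqP => // ->.
    - by move=> i; rewrite /u; case: eqP => // ->; apply/esym/PJ.
    - by apply: diag_fixed dQ _ => i; rewrite /u; case: eqP => // ->.
    - by move=> i; rewrite /u; case: eqP => // ->; apply/esym/QJ.
  pose w2 := [ffun i => u (w' i)].
  have w2E : (w2 : _ -> _) = u \o w' by apply/funext => i; rewrite ffunE.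
  have sw2 : stab w2.
    have /asboolP[wq wJ] := sw'; apply/asboolP; rewrite w2E gmap_comp uP.1 wq.
    by split=> // i /=; rewrite uP.2 wJ.
  have imE : im w2 = (u @: im w')%SET.
    apply/setP => l; apply/imsetP/imsetP => [[i _ ->]|[_ /imsetP[i _ ->] ->]].
      by exists (w' i); rewrite ?ffunE// imset_f.
    by exists i; rewrite ?ffunE// inE.
  have mw2 : (#|im w2| <= #|im w|)%N.
    by apply: leq_trans mw'; rewrite imE leq_imset_card.
  have zy : z = y.
    apply: IH sw2 mw2 _ _ zs ly; rewrite imE; apply/imsetP.
      by exists x => //; rewrite /u eqxx.
    by exists y => //; rewrite /u eq_sym (negbTE xy).
  have sub : im w2 \subset (im w' :\ x)%SET.
    apply/fintype.subsetP => l; rewrite imE => /imsetP[l' l'w ->].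
    rewrite !inE /u; case: (eqVneq l' x) => [_|l'x].
      by rewrite zy eq_sym xy.
    by rewrite l'x.
  have := leq_trans (mw _ sw2) (subset_leq_card sub).
  by rewrite -ltnS; rewrite (cardsD1 x (im w')) xw in mw'; rewrite ltnNge mw'.
have wJ i : pblock J (w i) = pblock J i by have /asboolP[] := sw.
have wE i j : pblock J i = pblock J j -> w i = w j.
  move=> ij; have /connectP[s ps ls] : connect (link P Q) (w i) (w j).
    by apply: JPQ; rewrite !wJ.
  by apply: (key s w) ps _ => //; rewrite imset_f.
have wq : gmap (g := M) w q = q by have /asboolP[] := sw.
have ww : w \o w = w by apply/funext => i /=; apply: wE.
have wK : has_kernel w J.
  move=> i j; apply/eqP/eqP => [E|]; last exact: wE.
  by rewrite -(wJ i) E wJ.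
by have [_] := diag_idempotent q pJ ww wK; apply.
Qed.

Lemma diagI P Q J : partition P [set: 'I_k.+1]%SET ->
  partition Q [set: 'I_k.+1]%SET -> partition J [set: 'I_k.+1]%SET ->
  refines P J -> refines Q J ->
  (forall i j, pblock J i = pblock J j -> connect (link P Q) i j) ->
  diag P `&` diag Q = diag J :> set (M k.+1).
Proof.
move=> pP pQ pJ PJ QJ JPQ; apply/seteqP; split=> q.
  by case; exact: diag_join.
by move=> dJ; split; [apply: diag_refines PJ dJ|apply: diag_refines QJ dJ].
Qed.

Lemma diagonals_intersection :
  closed_under_intersection (diagonals M k).
Proof.
move=> _ _ [P [pP [B BP B1] ->]] [Q [pQ _ ->]] _.
have [J pJ JE] := join_partition P Q.
have PJ : refines P J.
  by move=> i j ij; apply/eqP; rewrite JE connect1// /link /= ij eqxx.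
exists J; split=> //; last first.
  apply: diagI => //.
    by move=> i j ij; apply/eqP; rewrite JE connect1// /link /= ij eqxx orbT.
  by move=> i j ij; rewrite -JE ij.
have /and3P[_ tP _] := pP; have /and3P[_ tJ _] := pJ.
have /card_gt1P[x [y [xB yB xy]]] := B1.
have xJ z : z \in cover J by rewrite (cover_partition pJ) inE.
exists (pblock J x); first exact: pblock_mem.
apply/card_gt1P; exists x, y; split=> //; first by rewrite mem_pblock.
rewrite -eq_pblock//; apply/eqP/PJ.
by rewrite !(def_pblock tP BP).
Qed.

Lemma single_diagI (B B' : {set 'I_k.+1}) : (1 < #|B|)%N -> (1 < #|B'|)%N -> (B :&: B' != finset.set0)%SET ->
  diag (single_partition B) `&` diag (single_partition B') =
  diag (single_partition (B :|: B')) :> set (M k.+1).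
Proof.
move=> B1 B1' /set0Pn[b]; rewrite inE => /andP[bB bB'].
have bU : b \in B :|: B' by rewrite inE bB.
apply: diagI.
- exact: single_partitionP bB.
- exact: single_partitionP bB'.
- exact: single_partitionP bU.
- by apply: single_refines; [exists b|move=> i j iB jB; apply: single_pblock; rewrite inE ?iB ?jB].
- by apply: single_refines; [exists b|move=> i j iB jB; apply: single_pblock; rewrite inE ?iB ?jB ?orbT].
move=> i j /eqP; rewrite -(single_kernel bU) /collapse.
have step x : x \in B :|: B' -> link (single_partition B) (single_partition B') x b.
  by rewrite inE /= => /orP[xB|xB]; apply/orP; [left|right]; apply/eqP/single_pblock.
have step' x : x \in B :|: B' -> link (single_partition B) (single_partition B') b x.
  by rewrite inE /= => /orP[xB|xB]; apply/orP; [left|right]; apply/eqP/single_pblock.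
case: ifP => iU; case: ifP => jU /eqP.
- by move=> _; apply: connect_trans (connect1 (step _ iU)) (connect1 (step' _ jU)).
- by move=> E; rewrite -E bU in jU.
- by move=> E; rewrite E bU in iU.
- by move=> ->; exact: connect0.
Qed.

Lemma true_diagonals_sub : true_diagonals M k `<=` diagonals M k.
Proof.
move=> _ [B B1 ->]; have /card_gt0P[b bB] : (0 < #|B|)%N by exact: ltnW.
exists (single_partition B); split=> //; first exact: single_partitionP bB.
by exists B => //; rewrite !inE eqxx.
Qed.

(** [Q] is chosen with the most pairs in a common block. Its join with any admissible [P] is
    admissible by [diag_join], so it has no further pairs. *)
Lemma maximal_diag P0 q : partition P0 [set: 'I_k.+1]%SET -> diag P0 q ->
  exists Q, [/\ partition Q [set: 'I_k.+1]%SET, diag Q q &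
    forall P, partition P [set: 'I_k.+1]%SET -> diag P q -> refines P Q].
Proof.
move=> pP0 dP0.
pose rl P := [set ij : 'I_k.+1 * 'I_k.+1 | pblock P ij.1 == pblock P ij.2]%SET.
pose ok P := `[< partition P [set: 'I_k.+1]%SET /\ diag P q >].
have ok0 : ok P0 by apply/asboolP.
case: (@arg_maxnP _ P0 ok (fun P => #|rl P|) ok0) => Q /asboolP[pQ dQ] mQ.
exists Q; split=> // P pP dP.
have [J pJ JE] := join_partition P Q.
have PJ : refines P J by move=> i j ij; apply/eqP; rewrite JE connect1// /link /= ij eqxx.
have QJ : refines Q J by move=> i j ij; apply/eqP; rewrite JE connect1// /link /= ij eqxx orbT.
have dJ : diag J q.
  by apply: (diag_join pJ PJ QJ _ dP dQ) => i j ij; rewrite -JE ij.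
have E : rl Q = rl J.
  apply/eqP; rewrite eqEcard; apply/andP; split; last by apply: mQ; apply/asboolP.
  by apply/fintype.subsetP => -[i j]; rewrite !inE /= => /eqP/QJ ->.
move=> i j /PJ ij; have : (i, j) \in rl J by rewrite inE /= ij.
by rewrite -E inE => /eqP.
Qed.

End DiagonalCalculus.

(** * Transversality of disjoint true diagonals *)

Lemma idempotent_join (R : realType) n (E F : 'M[R]_n) :
  E *m E = E -> F *m F = F -> E *m F = F *m E ->
  (E + F - E *m F) *m (E + F - E *m F) = E + F - E *m F.
Proof.
move=> EE FF EF.
have h1 : E *m (E + F - E *m F) = E by rewrite mulmxBr mulmxDr EE mulmxA EE addrK.
have h2 : F *m (E + F - E *m F) = F.
  by rewrite mulmxBr mulmxDr FF EF mulmxA FF addrC addKr.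
by rewrite mulmxBl mulmxDl h1 h2 -mulmxA h2.
Qed.

Section Transversality.
Variables (R : realType) (M : gproduct R) (k : nat).

Lemma tangent_image (c : chart R (M k.+1) (mdim (M k.+1))) p S
    (e : 'I_k.+1 -> 'I_k.+1) x : coords c -> cdom c p ->
  gmap (g := M) e p = p -> (forall q, S (gmap (g := M) e q)) ->
  tangent c S p (x *m gdiff c p e).
Proof.
move=> co Dp ep Se W g oW Wp sg g0.
have hg := Ck1_fdiff oW (smooth_Ck sg 1%N) Wp.
have hgc : fdiff c (scalar_row (g \o c)) (gmap (g := M) e p) (grad g (c p)).
  by rewrite ep; exact: (fdiff_pull (chart_cont co.1 Dp) hg).
have h := fdiff_comp (gdiffP co Dp ep) (fdiff_pull (@gmap_cont _ _ _ _ e p) hgc).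
have h0 : fdiff c (scalar_row (g \o c) \o gmap (g := M) e) p 0.
  have := fdiff_cst c (0 : 'rV[R]_1) p; apply: fdiff_eq.
  have n1 : \forall q \near p, cdom c (gmap (g := M) e q).
    have := chart_near co.1 Dp; rewrite -{1}ep => hD; exact: (gmap_cont hD).
  have n2 : \forall q \near p, W (c (gmap (g := M) e q)).
    have := chart_cont co.1 Dp (open_near oW Wp); rewrite -{1}ep => hW.
    exact: (gmap_cont hW).
  by apply: filterS2 n1 n2 => q Dq Wq; apply/rowP => j; rewrite !mxE /= g0.
have [_ ->] := fdiff_derive (x *m gdiff c p e) hg.
by rewrite -mulmxA (chart_fdiff_unique co.1 Dp h h0) mulmx0 mxE.
Qed.

Lemma card_collapse b (B : {set 'I_k.+1}) : b \in B ->
  (#|collapse b B @: [set: 'I_k.+1]| + #|B :\ b| = k.+1)%N%SET.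
Proof.
move=> bB; rewrite (_ : (collapse b B @: _)%SET = ~: (B :\ b)%SET).
  by rewrite addnC cardsC card_ord.
apply/setP => i; rewrite !inE; apply/imsetP/idP => [[j _ ->]|].
  by rewrite /collapse; case: ifP => jB; rewrite ?eqxx// jB andbF.
rewrite negb_and negbK => /orP[/eqP ->|iB]; [exists b|exists i] => //.
  by rewrite /collapse bB.
by rewrite /collapse (negbTE iB).
Qed.

Lemma collapseC b b' (B B' : {set 'I_k.+1}) : b \in B -> b' \in B' ->
  (B :&: B' = finset.set0)%SET ->
  collapse b B \o collapse b' B' = collapse b' B' \o collapse b B.
Proof.
move=> bB bB' /setP d; apply/funext => i; rewrite /= /collapse.
have := d i; have := d b; have := d b'; rewrite !inE bB bB' !andbT /=.
by move=> h1 h2; case iB: (i \in B); case iB': (i \in B') => //= _;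
  rewrite ?h1 ?h2 ?iB ?iB'.
Qed.

Lemma card_collapse2 b b' (B B' : {set 'I_k.+1}) : b \in B -> b' \in B' ->
  (B :&: B' = finset.set0)%SET ->
  (#|(collapse b B \o collapse b' B') @: [set: 'I_k.+1]| + #|B :\ b| + #|B' :\ b'|
     = k.+1)%N%SET.
Proof.
move=> bB bB' d.
rewrite (_ : (_ @: _)%SET = ~: ((B :\ b) :|: (B' :\ b'))%SET).
  rewrite -addnA -[RHS]card_ord -(cardsC ((B :\ b) :|: (B' :\ b'))%SET) addnC.
  congr addn; rewrite cardsU (_ : (_ :&: _)%SET = finset.set0) ?cards0 ?subn0//.
  apply/setP => i; move/setP/(_ i): d; rewrite !inE.
  by case: (i \in B); case: (i \in B'); rewrite ?andbT ?andbF.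
move/setP: d => d; have := d b; have := d b'; rewrite !inE bB bB' !andbT /= => bb bb'.
apply/setP => i; rewrite !inE; apply/imsetP/idP => [[j _ ->]|].
  have := d j; rewrite !inE /= /collapse.
  case jB: (j \in B); case jB': (j \in B') => //= _;
    rewrite ?(bb, bb', bB, bB', jB, jB', eqxx, andbF)//.
rewrite negb_or !negb_and !negbK => /andP[h1 h2]; exists i; rewrite ?inE// /= /collapse.
case/orP: h1 => [/eqP->|/negbTE iB]; first by rewrite bb' bB.
case/orP: h2 => [/eqP->|/negbTE iB']; first by rewrite bB' bb.
by rewrite iB' iB.
Qed.

Lemma disjoint_transversal (B B' : {set 'I_k.+1}) : (1 < #|B|)%N -> (1 < #|B'|)%N ->
  (B :&: B' = finset.set0)%SET ->
  @Defs.transversal R (M k.+1) (diag (single_partition B)) (diag (single_partition B')).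
Proof.
move=> B1 B1' d p c dp dp' co Dp v.
have /card_gt0P[b bB] : (0 < #|B|)%N by exact: ltnW.
have /card_gt0P[b' bB'] : (0 < #|B'|)%N by exact: ltnW.
set e := collapse b B; set f := collapse b' B'.
have ee : e \o e = e := collapse_idem bB.
have ff : f \o f = f := collapse_idem bB'.
have ef : e \o f = f \o e := collapseC bB bB' d.
have diE q : diag (single_partition B) q <-> gmap (g := M) e q = q.
  exact: (diag_idempotent q (single_partitionP bB) ee (single_kernel bB)).
have diF q : diag (single_partition B') q <-> gmap (g := M) f q = q.
  exact: (diag_idempotent q (single_partitionP bB') ff (single_kernel bB')).
have ep : gmap (g := M) e p = p by apply/diE.
have fp : gmap (g := M) f p = p by apply/diF.
have efp : gmap (g := M) (e \o f) p = p by rewrite gmap_comp ep.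
have efef : (e \o f) \o (e \o f) = e \o f.
  rewrite {2}ef (_ : _ \o _ = e \o (f \o f) \o e)// ff.
  by rewrite (_ : _ \o _ = e \o (f \o e))// -ef (_ : _ \o _ = (e \o e) \o f)// ee.
set E := gdiff c p e; set F := gdiff c p f.
have EE : E *m E = E by rewrite /E -[in RHS]ee (gdiff_comp co Dp ep ep).
have FF : F *m F = F by rewrite /F -[in RHS]ff (gdiff_comp co Dp fp fp).
have EFE : gdiff c p (e \o f) = E *m F := gdiff_comp co Dp ep fp.
have EF : E *m F = F *m E.
  by have := gdiff_comp co Dp fp ep; rewrite -ef; exact: etrans (esym EFE).
(* The left side is idempotent, and since the dimension is affine in the rank, the relation
   [ne + nf = nef + k] makes its trace the dimension of the whole space. *)
have X1 : E + F - E *m F = 1%:M.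
  apply: idempotent_trace; first exact: idempotent_join.
  have pos (h : 'I_k.+1 -> 'I_k.+1) : exists n, #|(h @: [set: 'I_k.+1])%SET| = n.+1.
    case N: #|(h @: [set: 'I_k.+1])%SET| => [|n]; last by exists n.
    have : h ord0 \in (h @: [set: 'I_k.+1])%SET by apply: imset_f.
    by rewrite (cards0_eq N) inE.
  have [ne Ne] := pos e; have [nf Nf] := pos f; have [nef Nef] := pos (e \o f).
  have c1 := card_collapse bB; have c2 := card_collapse bB'.
  have c3 := card_collapse2 bB bB' d.
  rewrite -/e Ne in c1; rewrite -/f Nf in c2; rewrite -/e -/f Nef in c3.
  have N : (ne + nf = nef + k)%N by lia.
  rewrite raddfB raddfD /= -EFE.
  rewrite (gdiff_idempotent_trace co Dp ee ep Ne) (gdiff_idempotent_trace co Dp ff fp Nf).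
  rewrite (gdiff_idempotent_trace co Dp efef efp Nef) -[RHS]/((mdim (M k.+1))%:Z%:~R) gdim.
  rewrite -!intrD -rmorphB /=; congr (_ %:~R).
  have : (ne%:Z + nf%:Z = nef%:Z + k%:Z) by rewrite -!PoszD N.
  move: (gmu M) (gkappa M) (ne%:Z) (nf%:Z) (nef%:Z) (k%:Z) => m kk x y z t H.
  by rewrite (_ : t = x + y - z); [ring|rewrite H; ring].
exists (v *m E), ((v - v *m E) *m F); split.
- by apply: (tangent_image _ co Dp ep) => q; apply/diE; rewrite -gmap_comp ee.
- by apply: (tangent_image _ co Dp fp) => q; apply/diF; rewrite -gmap_comp ff.
- by rewrite mulmxBl -mulmxA addrA -mulmxDr -mulmxBr X1 mulmx1.
Qed.

End Transversality.

Lemma true_diagonals_intersection (R : realType) (M : gproduct R) k :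
  closed_under_nontransversal_intersection (true_diagonals M k).
Proof.
move=> _ _ [B B1 ->] [B' B1' ->] _ nt.
have [d|d] := eqVneq (B :&: B')%SET finset.set0.
  by case: nt; exact: disjoint_transversal.
exists (B :|: B')%SET; last exact: single_diagI.
exact: leq_trans B1 (subset_leq_card (finset.subsetUl B B')).
Qed.

(** * Linearizing coordinates *)

Section BoundaryChart.
Variables (R : realType) (M : gproduct R) (k : nat) (p : M k.+1).
Implicit Types c : chart R (M k.+1) (mdim (M k.+1)).
Notation n := (mdim (M k.+1)).

Definition boundary_fixed c (r : 'I_k.+1 -> 'I_k.+1) : Prop :=
  forall q b, b \in cbd c -> cdom c q -> cdom c (gmap (g := M) r q) ->
    c (gmap (g := M) r q) 0 b = c q 0 b.

(** By contravariance [a \o r = r] says that the map of [a] followed by that of [r] is the map of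
    [r]; as the latter preserves boundary coordinates, so does the former. *)
Lemma gdiff_boundary_col c r a b : coords c -> cdom c p -> boundary_fixed c r ->
  gmap (g := M) r p = p -> gmap (g := M) a p = p -> a \o r = r -> b \in cbd c ->
  col b (gdiff c p a) = col b 1%:M.
Proof.
move=> co Dp H rp ap ar bB.
apply: (chart_fdiff_unique co.1 Dp (fdiff_coord b (gdiffP co Dp ap))).
have := fdiff_coord b (fdiff_id c p); apply: fdiff_eq.
have nD f : gmap (g := M) f p = p -> \forall q \near p, cdom c (gmap (g := M) f q).
  by move=> fp; have := chart_near co.1 Dp; rewrite -{1}fp => hD; exact: (gmap_cont hD).
near=> q; apply/rowP => j; rewrite !mxE /=.
have Dq : cdom c q by near: q; exact: chart_near co.1 Dp.
have Da : cdom c (gmap (g := M) a q) by near: q; exact: nD.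
have Dr : cdom c (gmap (g := M) r q) by near: q; exact: nD.
by rewrite -(H q)// -(H (gmap (g := M) a q))// -gmap_comp ar.
Unshelve. all: by end_near. Qed.

Lemma Ck_row_mul K m l (W : set 'rV[R]_m) (A : 'M[R]_(m, l)) j :
  open W -> Ck K W (fun v => (v *m A) 0 j).
Proof.
move=> oW; rewrite (_ : (fun v => _) = fun v : 'rV[R]_m => \sum_i v 0 i * A i j).
  by apply: Ck_sum => // i _; apply: CkM => //; [exact: Ck_coord|exact: Ck_cst].
by apply/funext => v; rewrite mxE.
Qed.

(* p-cleanness wants linear equations that only involve the coordinates y. The
   last condition, achieved by a linear change of the y's, puts the directions
   of the boundary coordinates in the tangent space of the diagonal. *)
Lemma boundary_chart m (I : 'I_k.+1 -> 'I_m.+1) (s : 'I_m.+1 -> 'I_k.+1) :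
  cancel s I -> gmap (g := M) (s \o I) p = p ->
  exists c, [/\ adapted p c, boundary_fixed c (s \o I) &
    forall b, b \in cbd c -> row b (gdiff c p (s \o I)) = delta_mx 0 b].
Proof.
move=> sK sIp; have [c ac cB] := boundary_projection sK sIp.
have [co Dp cp _] := ac; set r := s \o I in sIp cB *.
have rr : r \o r = r by apply/funext => i; rewrite /r /= sK.
set rho := gdiff c p r.
have rhorho : rho *m rho = rho by rewrite /rho -(gdiff_comp co Dp sIp sIp) rr.
(* The part of [rho] leading from boundary directions to the y's. It squares to zero, so the shear
   [1%:M - N] is invertible, and it alters only the y's. *)
pose N := \matrix_(b, l) (if (b \in cbd c) && (l \notin cbd c) then rho b l else 0).
have NN : N *m N = 0.
  apply/matrixP => i j; rewrite !mxE big1// => l _; rewrite !mxE.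
  by case: (l \in cbd c); rewrite ?andbF ?mul0r ?mulr0.
have K1 : (1%:M + N) *m (1%:M - N) = 1%:M.
  by rewrite mulmxDl mul1mx mulmxBr mulmx1 NN subr0 subrK.
have K2 : (1%:M - N) *m (1%:M + N) = 1%:M.
  by rewrite mulmxBl mul1mx mulmxDr mulmx1 NN addr0 addrK.
have Ncol v b : b \in cbd c -> (v *m (1%:M - N)) 0 b = v 0 b :> R.
  move=> bB; rewrite mulmxBr mulmx1 !mxE big1 ?subr0// => l _.
  by rewrite !mxE bB andbF mulr0.
have [||||||c' [ac' bc' Dc' cE]] := @chart_change _ (M k.+1) c p setT setT setT
    (fun v => v *m (1%:M - N)) (fun v => v *m (1%:M + N)) (cbd c) co Dp openT Logic.I
    openT openT Logic.I _.
- by rewrite cp mul0mx.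
- by move=> v _; rewrite -mulmxA K2 mulmx1.
- by move=> v _; rewrite -mulmxA K1 mulmx1.
- by move=> K i; apply: Ck_row_mul; exact: openT.
- by move=> K i; apply: Ck_row_mul; exact: openT.
- by move=> v _; split=> h b bB; have := h b bB; rewrite Ncol.
have [co' Dp' _ _] := ac'.
exists c'; split=> //.
  move=> q b; rewrite bc' cE /= => bB Dq Dr; rewrite !Ncol//.
  have [_ ? _] := Dc' _ Dq; have [_ ? _] := Dc' _ Dr; exact: cB.
move=> b; rewrite bc' => bB.
have -> : gdiff c' p r = (1%:M + N) *m (rho *m (1%:M - N)).
  apply: (gdiff_eq co' Dp' sIp).
  have h1 : fdiff c' c p (1%:M + N).
    have := fdiff_mul c' (1%:M + N) p; apply: fdiff_eq; apply: nearW => q.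
    by rewrite cE /= -mulmxA K2 mulmx1.
  have := fdiff_comp h1 (fdiffM (1%:M - N) (gdiffP co Dp sIp)).
  by apply: fdiff_eq; apply: nearW => q; rewrite cE.
have rowb : row b (1%:M + N) = row b rho.
  apply/rowP => l; rewrite !mxE bB /=; have [lB|lB] := boolP (l \in cbd c) => /=.
    have /colP/(_ b) := gdiff_boundary_col co Dp cB sIp sIp rr lB.
    by rewrite !mxE addr0 => ->.
  by rewrite (_ : b == l = false) ?add0r//; apply: contraNF lB => /eqP <-.
by rewrite row_mul rowb mulmxA -row_mul rhorho -rowb -row_mul K1 rowE mulmx1.
Qed.

End BoundaryChart.

(** * Combinatorics and matrices of the maps keeping a single point *)

Section CollapseMaps.
Variables (k : nat) (r : 'I_k.+1 -> 'I_k.+1).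
Hypothesis rr : r \o r = r.
Implicit Types i j : 'I_k.+1.

(** The slot of a block: one of its points other than the representative [r i], the same for all [i]
    of the block. The default [i] arises only for singleton blocks. *)
Definition partner i := odflt i [pick j | (r j == r i) && (j != r i)].

(* place i puts the point i in the slot of its partner; this slot only depends
   on the block of i, so that the differences attached to the points of a block
   become comparable. *)
Definition keep i l := if l == i then i else r l.
Definition place i := if r i == i then r else fun l => if l == partner i then i else r l.
Definition unplace i l := if l == i then partner i else r l.

Let rE l : r (r l) = r l. Proof. by rewrite -[LHS]/((r \o r) l) rr. Qed.

Lemma partnerP i : r i != i -> r (partner i) = r i /\ partner i != r i.
Proof.
move=> ri; rewrite /partner; case: pickP => [j /andP[/eqP h1 h2] //|/(_ i)].
by rewrite eqxx eq_sym ri.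
Qed.

Lemma partner_moved i : r i != i -> r (partner i) != partner i.
Proof. by move=> /partnerP[-> h]; rewrite eq_sym. Qed.

Lemma partner_eq i j : r i != i -> r i = r j -> partner i = partner j.
Proof.
move=> ri ij; rewrite /partner -ij; case: pickP => [//|/(_ i)].
by rewrite eqxx eq_sym ri.
Qed.

Lemma moved_neq i l : r i != i -> (r l == i) = false.
Proof. by move=> ri; apply: contraNF ri => /eqP <-; rewrite rE. Qed.

Lemma r_keep i : r \o keep i = r.
Proof. by apply/funext => l; rewrite /= /keep; case: eqP => [->|_]; rewrite ?rE. Qed.

Lemma keep_r i : r i != i -> keep i \o r = r.
Proof. by move=> ri; apply/funext => l; rewrite /= /keep moved_neq// rE. Qed.

Lemma r_place i : r \o place i = r.
Proof.
rewrite /place; have [//|ri] := eqVneq (r i) i; apply/funext => l /=.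
by case: eqP => [->|_]; rewrite ?rE// (partnerP ri).1.
Qed.

Lemma place_r i : place i \o r = r.
Proof.
rewrite /place; have [//|ri] := eqVneq (r i) i; apply/funext => l /=.
by rewrite moved_neq ?partner_moved// rE.
Qed.

Lemma r_unplace i : r i != i -> r \o unplace i = r.
Proof.
move=> ri; apply/funext => l /=; rewrite /unplace.
by case: eqP => [->|_]; rewrite ?rE// (partnerP ri).1.
Qed.

Lemma unplace_r i : r i != i -> unplace i \o r = r.
Proof. by move=> ri; apply/funext => l; rewrite /= /unplace moved_neq// rE. Qed.

Lemma place_unplace i : r i != i -> place i \o unplace i = keep i.
Proof.
move=> ri; apply/funext => l; rewrite /= /place (negbTE ri) /unplace /keep.
by case: (l == i); rewrite ?eqxx// moved_neq ?partner_moved// rE.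
Qed.

Lemma keep_keep i : keep i \o keep i = keep i.
Proof.
apply/funext => l; rewrite /= /keep; case: (eqVneq l i) => [_|li]; first by rewrite eqxx.
by case: eqP => [//|_]; rewrite rE.
Qed.

Lemma keep_keep_neq i j : r i != i -> i != j -> keep i \o keep j = r.
Proof.
move=> ri ij; apply/funext => l; rewrite /= /keep; case: (eqVneq l j) => [->|lj].
  by rewrite eq_sym (negbTE ij).
by rewrite moved_neq// rE.
Qed.

Lemma keep_unplace i : r i != i -> keep (partner i) \o unplace i = unplace i.
Proof.
move=> ri; apply/funext => l; rewrite /= /keep /unplace; case: (l == i); first by rewrite eqxx.
by rewrite moved_neq ?partner_moved// rE.
Qed.

Lemma unplace_place i : r i != i -> unplace i \o place i = keep (partner i).
Proof.
move=> ri; apply/funext => l; rewrite /= /place (negbTE ri) /unplace /keep.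
by case: (l == partner i); rewrite ?eqxx// moved_neq// rE.
Qed.

Lemma unplace_place_neq i j : r i != i -> i != j -> unplace i \o place j = r.
Proof.
move=> ri ij; rewrite /place; case: (eqVneq (r j) j) => rj; first exact: unplace_r.
apply/funext => l; rewrite /= /unplace; case: (eqVneq l (partner j)) => [->|_].
  by rewrite eq_sym (negbTE ij) (partnerP rj).1.
by rewrite moved_neq// rE.
Qed.

(** Since [e] preserves blocks, [i] and [e i] have the same slot. If [e i] is the representative of
    its block, both sides are [r]. *)
Lemma comp_place e i : e \o r = r -> r \o e = r -> e \o place i = place (e i).
Proof.
move=> er re; have erE l : e (r l) = r l by rewrite -[LHS]/((e \o r) l) er.
have reE l : r (e l) = r l by rewrite -[LHS]/((r \o e) l) re.
rewrite /place reE; case: (eqVneq (r i) i) => ri.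
  by rewrite -{2}ri erE eqxx er.
case: (eqVneq (r i) (e i)) => rei; apply/funext => l /=.
  by case: eqP => [->|_]; rewrite ?erE// -rei (partnerP ri).1.
rewrite (_ : partner (e i) = partner i); last by apply: partner_eq; rewrite reE.
by case: eqP => // _; rewrite erE.
Qed.

Lemma card_keep i : r i != i ->
  (#|keep i @: [set: 'I_k.+1]| = #|r @: [set: 'I_k.+1]|.+1)%N%SET.
Proof.
move=> ri; have iN : i \notin (r @: [set: 'I_k.+1])%SET.
  by apply/imsetP => -[l _ E]; move: (moved_neq l ri); rewrite -E eqxx.
rewrite (_ : (keep i @: _)%SET = (i |: (r @: [set: 'I_k.+1]))%SET) ?cardsU1 ?iN//.
apply/setP => l; rewrite !inE; apply/imsetP/idP => [[j _ ->]|/orP[/eqP->|/imsetP[j _ ->]]].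
- by rewrite /keep; case: (j == i); rewrite ?eqxx//; apply/orP; right; apply: imset_f; rewrite inE.
- by exists i; rewrite ?inE// /keep eqxx.
- by exists (r j); rewrite ?inE// /keep moved_neq// rE.
Qed.

Lemma card_moved : (#|[pred i | r i != i]| + #|r @: [set: 'I_k.+1]| = k.+1)%N%SET.
Proof.
rewrite addnC -[RHS]card_ord -(cardC (r @: [set: 'I_k.+1])%SET); congr (_ + _)%N.
apply: eq_card => i; rewrite !inE; congr (~~ _).
apply/eqP/imsetP => [E|[l _ ->]]; last exact: rE.
by exists i.
Qed.

End CollapseMaps.

Section CollapseAlgebra.
Variables (R : realType) (k n : nat) (r : 'I_k.+1 -> 'I_k.+1).
Variable rho : ('I_k.+1 -> 'I_k.+1) -> 'M[R]_n.
Hypotheses (rr : r \o r = r)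
  (rho_comp : forall a b, r \o a = r -> r \o b = r -> rho (a \o b) = rho a *m rho b).

Definition keep_sum : 'M[R]_n := rho r + \sum_(i | r i != i) (rho (keep r i) - rho r).

Let Rr : rho r *m rho r = rho r. Proof. by rewrite -rho_comp ?rr. Qed.

Lemma rho_rM a : r \o a = r -> rho r *m rho a = rho r.
Proof. by move=> ra; rewrite -rho_comp// ra. Qed.

Lemma rho_Mr a : r \o a = r -> a \o r = r -> rho a *m rho r = rho r.
Proof. by move=> ra ar; rewrite -rho_comp// ar. Qed.

(** [rho r] and the differences [D i] are pairwise orthogonal idempotents, as composing two
    different [keep] maps gives back [r]. *)
Lemma keep_sum_idempotent : keep_sum *m keep_sum = keep_sum.
Proof.
rewrite /keep_sum; pose D i := rho (keep r i) - rho r; rewrite -/(D _).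
have rk i : r \o keep r i = r by exact: r_keep.
have RD i : rho r *m D i = 0 by rewrite mulmxBr Rr rho_rM// subrr.
have DR i : r i != i -> D i *m rho r = 0.
  by move=> ri; rewrite mulmxBl Rr rho_Mr ?keep_r// subrr.
have DD i : r i != i -> D i *m D i = D i.
  move=> ri; rewrite [X in _ *m X]/D mulmxBr DR// subr0 mulmxBl -rho_comp//.
  by rewrite keep_keep// rho_rM.
have DDn i j : r i != i -> j != i -> D i *m D j = 0.
  move=> ri ji; rewrite [X in _ *m X]/D mulmxBr DR// subr0 mulmxBl -rho_comp//.
  by rewrite keep_keep_neq// 1?eq_sym// rho_rM// subrr.
rewrite mulmxDl; congr (_ + _).
  by rewrite mulmxDr Rr mulmx_sumr big1 ?addr0// => i _; exact: RD.
rewrite mulmx_suml; apply: eq_bigr => i ri; rewrite mulmxDr DR// add0r.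
rewrite mulmx_sumr (bigD1 i)//= -/(D i) DD// big1 ?addr0// => j /andP[_ ji].
exact: DDn.
Qed.

(** Each difference is factored through the slot of [i]; in this form the sum is the linear part of
    [lin]. *)
Lemma keep_sumE : keep_sum = rho r *m rho r + \sum_(i | r i != i)
  (rho (place r i) - rho r) *m (rho (unplace r i) - rho r).
Proof.
rewrite Rr; congr (_ + _); apply: eq_bigr => i ri.
have rp := r_place rr i; have rt := r_unplace rr ri.
rewrite mulmxBl !mulmxBr Rr (rho_rM rt) (rho_Mr rp (place_r rr i)).
by rewrite -(rho_comp rp rt) place_unplace// subrr subr0.
Qed.

Lemma unplace_factor i : r i != i ->
  rho (unplace r i) - rho r = (rho (keep r (partner r i)) - rho r) *m rho (unplace r i).
Proof.
move=> ri; have rt := r_unplace rr ri; rewrite mulmxBl (rho_rM rt).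
by rewrite -(rho_comp (r_keep rr _) rt) keep_unplace.
Qed.

Lemma mul_place (b : 'rV[R]_n) (o : 'I_k.+1 -> 'rV[R]_n) i :
  (r i = i -> o i = 0) ->
  (b *m rho r + \sum_(j | r j != j) o j *m (rho (unplace r j) - rho r)) *m rho (place r i) =
  b *m rho r + o i *m (rho (keep r (partner r i)) - rho r).
Proof.
move=> oi; have rp := r_place rr i.
rewrite mulmxDl -mulmxA (rho_rM rp); congr (_ + _).
rewrite mulmx_suml.
have term j : r j != j -> o j *m (rho (unplace r j) - rho r) *m rho (place r i) =
    o j *m (rho (unplace r j \o place r i) - rho r).
  by move=> rj; rewrite -mulmxA mulmxBl -(rho_comp (r_unplace rr rj) rp) (rho_rM rp).
rewrite (eq_bigr _ term); have [ri|ri] := eqVneq (r i) i.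
  rewrite big1 => [|j rj]; first by rewrite oi// mul0mx.
  rewrite unplace_place_neq ?subrr ?mulmx0//.
  by apply: contraNneq rj => ->; rewrite ri.
rewrite (bigD1 i)//= unplace_place// big1 ?addr0// => j /andP[rj ji].
by rewrite unplace_place_neq// subrr mulmx0.
Qed.

End CollapseAlgebra.

Section Linearization.
Variables (R : realType) (M : gproduct R) (k : nat) (p : M k.+1).
Variables (r : 'I_k.+1 -> 'I_k.+1) (c : chart R (M k.+1) (mdim (M k.+1))).
Notation n := (mdim (M k.+1)).
Hypotheses (rr : r \o r = r)
  (stab : forall a, r \o a = r -> gmap (g := M) a p = p)
  (co : coords c) (Dp : cdom c p).
Notation rho := (gdiff c p).

Lemma gdiff_comp_stab a b : r \o a = r -> r \o b = r ->
  rho (a \o b) = rho a *m rho b.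
Proof. by move=> ra rb; exact: (gdiff_comp co Dp (stab ra) (stab rb)). Qed.

Definition offset i q : 'rV[R]_n :=
  c (gmap (g := M) (place r i) q) - c (gmap (g := M) r q).

(* By mul_place, the differences zcoord i are linear functions of lin. *)
Definition lin q : 'rV[R]_n := c (gmap (g := M) r q) *m rho r +
  \sum_(i | r i != i) offset i q *m (rho (unplace r i) - rho r).

Definition zcoord i q : 'rV[R]_n := offset i q *m (rho (keep r (partner r i)) - rho r).

Lemma keep_sum1 : keep_sum r rho = 1%:M.
Proof.
apply: idempotent_trace; first exact: (keep_sum_idempotent rr gdiff_comp_stab).
have [m Em] : exists m, #|(r @: [set: 'I_k.+1])%SET| = m.+1.
  case N: #|(r @: [set: 'I_k.+1])%SET| => [|m]; last by exists m.
  have : r ord0 \in (r @: [set: 'I_k.+1])%SET by apply: imset_f.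
  by rewrite (cards0_eq N) inE.
have tr := gdiff_idempotent_trace co Dp rr (stab rr) Em.
have tk i : r i != i -> \tr (rho (keep r i) - rho r) = (gkappa M)%:~R.
  move=> ri; have Ek := card_keep rr ri; rewrite Em in Ek.
  have := gdiff_idempotent_trace co Dp (keep_keep rr i) (stab (r_keep rr i)) Ek.
  have trB (A B : 'M[R]_n) : \tr (A - B) = \tr A - \tr B by rewrite raddfB.
  rewrite trB tr => ->.
  rewrite -rmorphB /=; congr (_ %:~R).
  by rewrite (_ : m.+1%:Z = m%:Z + 1); [ring|rewrite -PoszD addn1].
rewrite /keep_sum mxtraceD tr raddf_sum (eq_bigr _ tk) sumr_const.
(* With [m.+1] the rank of [r], each of the [k - m] moved points contributes trace [gkappa M], which
   completes the trace of [rho r] to the full dimension. *)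
rewrite -[RHS]/((mdim (M k.+1))%:Z%:~R) gdim -rmorphMn -rmorphD /=.
congr (_ %:~R).
have := card_moved rr; rewrite Em; set N := #|_| => EN.
have -> : k = (N + m)%N by lia.
by rewrite PoszD -mulr_natl natz; ring.
Qed.

Lemma fdiff_gmap a : r \o a = r -> fdiff c (fun q => c (gmap (g := M) a q)) p (rho a).
Proof. by move=> ra; exact: (gdiffP co Dp (stab ra)). Qed.

Lemma lin_fdiff : fdiff c lin p 1%:M.
Proof.
rewrite -keep_sum1 (keep_sumE rr gdiff_comp_stab).
apply: fdiffD; first exact: (fdiffM _ (fdiff_gmap rr)).
apply: fdiff_sum => i ri; apply: fdiffM.
exact: (fdiffB (fdiff_gmap (r_place rr i)) (fdiff_gmap rr)).
Qed.

Lemma offset0 i q : r i = i -> offset i q = 0.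
Proof. by move=> ri; rewrite /offset /place ri eqxx subrr. Qed.

Lemma lin_place i q :
  lin q *m rho (place r i) = c (gmap (g := M) r q) *m rho r + zcoord i q.
Proof.
exact: (mul_place rr gdiff_comp_stab (c (gmap (g := M) r q)) (o := offset^~ q) (@offset0 i q)).
Qed.

Lemma lin_place_eq0 e i q :
  lin q *m (rho (place r i) - rho (place r (e i))) = 0 <-> zcoord i q = zcoord (e i) q.
Proof.
rewrite mulmxBr !lin_place opprD addrACA subrr add0r.
by move: (zcoord i q) (zcoord (e i) q) => x y; split=> [/subr0_eq|->]; rewrite ?subrr.
Qed.

Lemma zcoord_offset e i q : r \o e = r ->
  zcoord (e i) q = offset (e i) q *m (rho (keep r (partner r i)) - rho r).
Proof.
move=> re; have [E|E] := eqVneq (r (e i)) (e i).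
  have E0 := offset0 q E; rewrite /zcoord E0; exact: etrans (mul0mx _ _) (esym (mul0mx _ _)).
rewrite /zcoord (@partner_eq _ r (e i) i)//.
by rewrite -[LHS]/((r \o e) i) re.
Qed.

Lemma lin_fixed e i q : e \o r = r -> r \o e = r -> gmap (g := M) e q = q ->
  lin q *m (rho (place r i) - rho (place r (e i))) = 0.
Proof.
move=> er re eq; apply/lin_place_eq0; rewrite zcoord_offset// /zcoord.
by rewrite /offset -[in LHS]eq -!gmap_comp comp_place// er.
Qed.

(** Replacing [q] by its image under [e] turns [offset i] into [offset (e i)]. The sum [lin] sees
    offsets only through [zcoord], by [unplace_factor], and the equations equate [zcoord i] with
    [zcoord (e i)]. *)
Lemma lin_linear e q : e \o r = r -> r \o e = r ->
  (forall i, lin q *m (rho (place r i) - rho (place r (e i))) = 0) ->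
  lin (gmap (g := M) e q) = lin q.
Proof.
move=> er re H.
have rS : gmap (g := M) r (gmap (g := M) e q) = gmap (g := M) r q.
  by rewrite -gmap_comp er.
have oS i : offset i (gmap (g := M) e q) = offset (e i) q.
  by rewrite /offset rS -gmap_comp comp_place.
rewrite /lin rS; congr (_ + _); apply: eq_bigr => i ri; rewrite oS.
rewrite (unplace_factor rr gdiff_comp_stab ri) !mulmxA -/(zcoord i q).
by rewrite -(zcoord_offset i q re); have /lin_place_eq0 <- := H i.
Qed.

End Linearization.

Section SmoothCombinations.
Variables (R : realType) (X : topologicalType) (n : nat) (c : chart R X n) (p : X).

Lemma smooth_in_cst (a : R) : smooth_in c (fun=> a) p.
Proof.
exists setT, (fun=> a); split=> //; first exact: openT.
  by apply: Ck_smooth => k; exact: Ck_cst.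
exact: nearW.
Qed.

Lemma smooth_inD f g : smooth_in c f p -> smooth_in c g p ->
  smooth_in c (fun q => f q + g q) p.
Proof.
move=> [W [F [oW Wp sF fF]]] [V [G [oV Vp sG gG]]].
have oWV : open (W `&` V) by exact: openI.
exists (W `&` V), (fun v => F v + G v); split=> //.
  apply: Ck_smooth => k; apply: CkD => //.
    by apply: (@Ck_sub _ _ _ _ W) => [v []//|]; exact: smooth_Ck.
  by apply: (@Ck_sub _ _ _ _ V) => [v []//|]; exact: smooth_Ck.
by apply: filterS2 fF gG => q -> ->.
Qed.

Lemma smooth_in_sum (I : Type) (s : seq I) (P : pred I) (f : I -> X -> R) :
  (forall i, P i -> smooth_in c (f i) p) ->
  smooth_in c (fun q => \sum_(i <- s | P i) f i q) p.
Proof.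
move=> h; elim: s => [|i s IH].
  apply: smooth_in_near (smooth_in_cst 0); apply: nearW => q.
  by rewrite big_nil.
case Pi: (P i).
  apply: smooth_in_near (smooth_inD (h i Pi) IH); apply: nearW => q.
  by rewrite big_cons Pi.
by apply: smooth_in_near IH; apply: nearW => q; rewrite big_cons Pi.
Qed.

Lemma smooth_in_mulmx m l (F : X -> 'rV[R]_m) (A : 'M[R]_(m, l)) i :
  {for p, continuous c} ->
  (forall j, smooth_in c (fun q => F q 0 j) p) ->
  smooth_in c (fun q => (F q *m A) 0 i) p.
Proof.
move=> cc sF; apply: (smooth_in_comp (G := fun v => (v *m A) 0 i) cc sF openT) => // k.
by apply: Ck_row_mul; exact: openT.
Qed.

End SmoothCombinations.

Lemma mulmx_col_id (R : realType) n (v : 'rV[R]_n) (A : 'M[R]_n) b :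
  col b A = col b 1%:M -> (v *m A) 0 b = v 0 b.
Proof.
move=> h; have E (w : 'rV[R]_n) : w 0 b = (w *m delta_mx b 0 : 'rV_1) 0 0.
  by rewrite -colE mxE.
by rewrite (E (v *m A)) -mulmxA -colE h colE mul1mx -E.
Qed.

(** * The linearizing chart *)

Section LinearizingChart.
Variables (R : realType) (M : gproduct R) (k : nat) (p : M k.+1).
Variables (r : 'I_k.+1 -> 'I_k.+1).
Notation n := (mdim (M k.+1)).
Hypotheses (rr : r \o r = r)
  (stab : forall a, r \o a = r -> gmap (g := M) a p = p).

Section InChart.
Variables (c : chart R (M k.+1) n).
Hypotheses (ac : adapted p c) (bc : boundary_fixed c r)
  (rc : forall b, b \in cbd c -> row b (gdiff c p r) = delta_mx 0 b).
Notation rho := (gdiff c p).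

Let co : coords c. Proof. by case: ac. Qed.
Let Dp : cdom c p. Proof. by case: ac. Qed.
Let cp : c p = 0. Proof. by case: ac. Qed.
Let cc : {for p, continuous c}. Proof. exact: chart_cont co.1 Dp. Qed.

Lemma gmap_smooth_in a l : r \o a = r ->
  smooth_in c (fun q => c (gmap (g := M) a q) 0 l) p.
Proof.
move=> ra; have Da : cdom c (gmap (g := M) a p) by rewrite (stab ra).
exact: ((gmap_smooth M a).2 p c c co Dp co Da l).
Qed.

Lemma lin_smooth_in l : smooth_in c (fun q => lin p r c q 0 l) p.
Proof.
have sr i : smooth_in c (fun q => c (gmap (g := M) r q) 0 i) p by exact: gmap_smooth_in.
have so i j : smooth_in c (fun q => offset r c i q 0 j) p.
  have sn : smooth_in c (fun q => (c (gmap (g := M) r q) *m (- 1%:M)) 0 j) p.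
    exact: smooth_in_mulmx cc sr.
  apply: smooth_in_near (smooth_inD (gmap_smooth_in j (r_place rr i)) sn).
  by apply: nearW => q; rewrite mulmxN mulmx1 !mxE.
have s1 := smooth_in_mulmx (rho r) l cc sr.
have s2 i := smooth_in_mulmx (rho (unplace r i) - rho r) l cc (so i).
have s3 : smooth_in c (fun q => \sum_(i | r i != i)
   (offset r c i q *m (rho (unplace r i) - rho r)) 0 l) p.
  by apply: smooth_in_sum => i _; exact: s2.
apply: smooth_in_near (smooth_inD s1 s3); apply: nearW => q.
by rewrite /lin [RHS]mxE summxE.
Qed.

Lemma near_gmap a : r \o a = r -> forall V, nbhs p V -> nbhs p (gmap (g := M) a @^-1` V).
Proof. by move=> ra V; rewrite -{1}(stab ra) => hV; exact: (gmap_cont hV). Qed.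

Lemma lin_boundary b q : b \in cbd c -> cdom c q -> cdom c (gmap (g := M) r q) ->
  lin p r c q 0 b = c q 0 b.
Proof.
move=> bB Dq Dr; have H a (ra : r \o a = r) (ar : a \o r = r) :=
  gdiff_boundary_col co Dp bc (stab rr) (stab ra) ar bB.
rewrite /lin mxE (mulmx_col_id _ (H r rr rr)) bc// summxE big1 ?addr0// => i ri.
have Z : col b (rho (unplace r i) - rho r) = 0.
  rewrite raddfB /= (H r rr rr) (H _ (r_unplace rr ri) (unplace_r rr ri)).
  exact: subrr.
have E (w : 'rV[R]_n) : w 0 b = (w *m delta_mx b 0 : 'rV_1) 0 0 by rewrite -colE mxE.
by rewrite E -mulmxA -colE Z mulmx0 mxE.
Qed.

Lemma rho_row a b : r \o a = r -> b \in cbd c -> row b (rho a) = delta_mx 0 b.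
Proof.
move=> ra bB; have E := gdiff_comp_stab stab co Dp rr ra.
rewrite ra in E; by rewrite -[RHS](rc bB) E row_mul (rc bB) -rowE.
Qed.

Lemma lin_chart : exists c' : chart R (M k.+1) n, [/\ adapted p c', cbd c' = cbd c,
  forall q, cdom c' q -> c' q = lin p r c q &
  forall q a, cdom c' q -> r \o a = r ->
    lin p r c (gmap (g := M) a q) = lin p r c q -> gmap (g := M) a q = q].
Proof.
have [W [G [oW Wp sG nG]]] := smooth_in_rV lin_smooth_in.
(* On the image of [c] near [c p] this agrees with the local expression [G] of [lin]. Keeping the
   boundary coordinates literally makes [g] respect the sector off that image too, as [chart_change]
   requires. *)
pose g (v : 'rV[R]_n) := \row_l (if l \in cbd c then v 0 l else G v 0 l) : 'rV[R]_n.
have sg K i : Ck K W (fun v => g v 0 i).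
  have [iB|/negbTE iB] := boolP (i \in cbd c).
    rewrite (_ : (fun v => _) = fun v : 'rV[R]_n => v 0 i); first exact: Ck_coord.
    by apply/funext => v; rewrite mxE iB.
  rewrite (_ : (fun v => _) = fun v => G v 0 i); first exact: sG.
  by apply/funext => v; rewrite mxE iB.
have nD := chart_near co.1 Dp.
have ng : \forall q \near p, lin p r c q = g (c q).
  apply: filterS3 nG nD (near_gmap rr nD) => q E Dq Dr.
  apply/rowP => l; rewrite [RHS]mxE; case: ifP => lB; first exact: lin_boundary.
  by rewrite E.
have gp : g (c p) = 0.
  have E : lin p r c p = g (c p) := nbhs_singleton ng.
  rewrite -E /lin (stab rr) cp mul0mx add0r big1// => i _.
  by rewrite /offset (stab rr) (stab (r_place rr i)) subrr mul0mx.
have W0 : W 0 by rewrite -cp.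
have g0 : g 0 = 0 by rewrite -[in LHS]cp.
have Dg : fdiff id g 0 1%:M.
  pose J := \matrix_(i, j) 'D_(delta_mx 0 i) (fun v => g v 0 j) 0.
  have hJ : fdiff id g 0 J.
    apply: fdiff_coords => j.
    rewrite (_ : col j J = grad (fun v => g v 0 j) 0); last first.
      by apply/colP => l; rewrite !mxE.
    exact: Ck1_fdiff (sg 1%N j) W0.
  have hJc : fdiff id g (c p) J by rewrite cp.
  have h1 : fdiff c (g \o c) p J := fdiff_pull cc hJc.
  have h2 : fdiff c (g \o c) p 1%:M := fdiff_eq ng (lin_fdiff rr stab co Dp).
  by rewrite -(chart_fdiff_unique co.1 Dp h1 h2).
have [W1 [W2 [h [oW1 oW2 W10 W1W [gK hK sh]]]]] := inverse_function oW W0 g0 sg Dg.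
pose V := [set q | [/\ cdom c q, W1 (c q) & lin p r c q = g (c q)]].
have nV : nbhs p V.
  have n1 : \forall q \near p, W1 (c q).
    have W1p : W1 (c p) by rewrite cp.
    exact: (cc (open_near oW1 W1p)).
  by apply: filterS3 nD n1 ng => q.
(* The images of [q] under the finitely many maps with [r \o a = r] must stay where [lin] is
   injective, so that equality of [lin] at [q] and at its image gives a fixed point. *)
pose U := V `&` [set q | forall a : {ffun 'I_k.+1 -> 'I_k.+1},
   r \o a = r -> V (gmap (g := M) a q)].
have /nbhs_interior nU : nbhs p U.
  apply: filterI => //; apply: filter_forall => a.
  case: (pselect (r \o a = r)) => [ra|na]; last by apply: nearW.
  by have := near_gmap ra nV; apply: filterS.
have W1p : W1 (c p) by rewrite cp.
have sgW1 K i : Ck K W1 (fun v => g v 0 i) := Ck_sub W1W (sg K i).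
have sec v : W1 v -> sector (cbd c) v <-> sector (cbd c) (g v).
  by move=> _; split=> hv i iB; have := hv i iB; rewrite mxE iB.
have [c' [ac' bc' Dc' cE]] := chart_change co Dp (open_interior U)
  (nbhs_singleton nU) oW1 oW2 W1p gp gK hK sgW1 sh sec.
exists c'; split=> // [q Dq|q a Dq ra E].
  have [/interior_subset[[_ _ Eq] _] _ _] := Dc' q Dq.
  by rewrite cE /= Eq.
have [/interior_subset[[Dcq W1q Eq] /(_ (finfun a)) Ua] _ _] := Dc' q Dq.
have fa : (finfun a : _ -> _) = a by apply/funext => i; rewrite ffunE.
move: Ua; rewrite fa => /(_ ra)[Dca W1a Ea].
have [[_ inj _ _] _] := co; apply: inj => //.
by rewrite -(gK _ W1q).2 -(gK _ W1a).2 -Eq -Ea E.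
Qed.

End InChart.
End LinearizingChart.

(** * p-cleanness of the diagonals and the conclusion *)

Lemma diag_range (R : realType) (M : gproduct R) k (P : {set {set 'I_k.+1}}) :
  finset.partition P [set: 'I_k.+1]%SET ->
  exists n (I : 'I_k.+1 -> 'I_n.+1), (forall j, exists i, I i = j) /\
    diag P = range (gmap (g := M) I).
Proof.
move=> pP; pose z := (fun=> ord0) : 'I_k.+1 -> 'I_k.+1.
have [//|e [ee eP _]] := @partition_idempotent k z P erefl.
have [n [I [s [sK sI _]]]] := idempotent_factor ee.
exists n, I; split=> [j|]; first by exists (s j).
apply/seteqP; split=> q.
  move=> /(diag_idempotent _ pP ee eP) eq.
  by exists (gmap (g := M) s q) => //; rewrite -gmap_comp sI.
move=> [q' _ <-]; apply/(diag_idempotent _ pP ee eP).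
by rewrite -gmap_comp -sI; congr (gmap _ q'); apply/funext => i /=; rewrite sK.
Qed.

Lemma diagonals_p_clean (R : realType) (M : gproduct R) k : p_clean (diagonals M k).
Proof.
split.
- apply: (@sub_finite_set _ _ (range (@diag R M k))).
    by move=> _ [P [_ _ ->]]; exists P.
  exact: finite_image.
- move=> _ [P [pP _ ->]]; have [n [I [sI ->]]] := diag_range M pP.
  by have [[]] := gmap_surj M sI.
move=> p [_ [P0 [pP0 _ ->]] dP0].
have [Q [pQ dQ maxQ]] := maximal_diag pP0 dP0.
pose z := (fun=> ord0) : 'I_k.+1 -> 'I_k.+1.
have [//|r [rr rQ _]] := @partition_idempotent k z Q erefl.
have stab a : r \o a = r -> gmap (g := M) a p = p.
  move=> ra; apply: diag_fixed dQ _ => i; apply/eqP; rewrite -rQ.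
  by rewrite -[r (a i)]/((r \o a) i) ra.
have [m [I [s [sK sI _]]]] := idempotent_factor rr.
have sIp : gmap (g := M) (s \o I) p = p by rewrite sI; exact: stab.
have [c [ac bc rc]] := boundary_chart sK sIp; rewrite sI in bc rc.
have [c' [ac' bc' c'E c'inj]] := lin_chart rr stab ac bc.
exists c' => // _ [P [pP _ ->]] dP.
have PQ := maxQ P pP dP.
have rP i j : finset.pblock P i = finset.pblock P j -> r i = r j.
  by move=> /PQ ij; apply/eqP; rewrite rQ ij.
(* Unlike an arbitrary idempotent with kernel [P], this one satisfies [e \o r = r], as the
   linearization demands. *)
have [e [ee eP er]] := partition_idempotent rr rP.
have re : r \o e = r.
  apply/funext => i /=; apply: rP; apply/eqP; rewrite -eP.
  by rewrite -[e (e i)]/((e \o e) i) ee.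
pose D i := gdiff c p (place r i) - gdiff c p (place r (e i)).
pose T := ('I_k.+1 * 'I_(mdim (M k.+1)))%type.
(* One equation for each point [i] and each entry [t] of [lin p r c q *m D i]; no boundary
   coordinate is required to vanish. *)
pose L : 'M[R]_(mdim (M k.+1), #|{: T}|) :=
  \matrix_(l, j) D (enum_val j).1 l (enum_val j).2.
exists finset.set0, _, L; split; first exact: finset.sub0set.
move=> q Dq; rewrite c'E//.
(* The boundary rows of all [place] differentials agree, so the equations involve only the y's. *)
have Drow i b : b \in cbd c -> row b (D i) = 0.
  move=> bB; rewrite raddfB /= !(rho_row rr stab ac rc (r_place rr _) bB).
  exact: subrr.
have sumE i t : \sum_(l | l \notin cbd c') D i l t * lin p r c q 0 l =
    (lin p r c q *m D i) 0 t.
  rewrite [RHS]mxE [RHS](bigID (mem (cbd c))) /= [X in _ = X + _]big1 ?add0r => [|b bB].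
    by rewrite bc'; apply: eq_bigr => l _; rewrite mulrC.
  have /rowP/(_ t) := Drow i b bB; rewrite !mxE => ->.
  by rewrite mulr0.
have diE := diag_idempotent q pP ee eP.
split=> [/diE eq|[_ H]].
  split=> [i|j]; first by rewrite inE.
  under eq_bigr do rewrite mxE.
  have [co Dp _ _] := ac.
  by rewrite sumE /D (lin_fixed rr stab co Dp _ er re eq) mxE.
apply/diE; apply: c'inj => //; have [co Dp _ _] := ac.
apply: (lin_linear rr stab co Dp er re) => i; apply/rowP => t.
have := H (enum_rank (i, t)); under eq_bigr do rewrite mxE enum_rankK.
by rewrite sumE => E; rewrite [RHS]mxE; exact: E.
Qed.

Theorem theorem2 (R : realType) (M : gproduct R) (hM : gproduct_compact M)
    (k : nat) (k_ge2 : (2 <= k.+1)%N) :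
  (p_clean (diagonals M k) /\ closed_under_intersection (diagonals M k)) /\
  (p_clean (true_diagonals M k) /\
   closed_under_nontransversal_intersection (true_diagonals M k)).
Proof.
have [fin sub loc] := diagonals_p_clean M k; have td := @true_diagonals_sub R M k.
split; first by split; [|exact: diagonals_intersection].
split; last exact: true_diagonals_intersection.
split; first exact: sub_finite_set td fin.
  by move=> S /td; exact: sub.
move=> p [S tS Sp]; have [|c ac hc] := loc p; first by exists S => //; exact: td.
by exists c => // T /td; exact: hc.
Qed.
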